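(* Let $(M,\omega)$ be a symplectic manifold of dimension $2n$, let $\Lambda=\omega^{-1}$ be the corresponding Poisson tensor, and let $1\le k\le n$. The $2k$-bracket on $C^\infty(M)$ defined by $$\{f_1,\dots,f_{2k}\}\,\frac{\omega^n}{n!}=k!\,\mathrm{d}f_1\wedge\cdots\wedge \mathrm{d}f_{2k}\wedge\frac{\omega^{n-k}}{(n-k)!}$$ is generated by the $2k$-vector field $\Lambda^k$, i.e. $\{f_1,\dots,f_{2k}\}=\langle \mathrm{d}f_1\wedge\cdots\wedge \mathrm{d}f_{2k},\Lambda^k\rangle$ for all $f_1,\dots,f_{2k}\in C^\infty(M)$. It is a $2k$-Poisson bracket.
   Context: Powers are wedge powers: $\omega^j=\omega\wedge\cdots\wedge\omega$ ($j$ times), $\omega^0=1$, and $\Lambda^k=\Lambda\wedge\cdots\wedge\Lambda$ ($k$ times). The Poisson tensor $\Lambda=\omega^{-1}$ is the bivector field which in Darboux coordinates $(q_1,\dots,q_n,p_1,\dots,p_n)$ with $\omega=\sum_j \mathrm{d}p_j\wedge \mathrm{d}q_j$ is $\Lambda=\sum_j\partial_{p_j}\wedge\partial_{q_j}$. The pairing is $\langle \theta_1\wedge\cdots\wedge\theta_{2k}, X_1\wedge\cdots\wedge X_{2k}\rangle=\det(\theta_i(X_j))$. A $2k$-Poisson bracket (in the sense of de Azcárraga, Perelomov and Pérez Bueno) is a $2k$-linear, totally antisymmetric bracket on $C^\infty(M)$ that is a derivation in each argument (Leibniz rule) and satisfies the generalized Jacobi identity $$\sum_{\sigma\in S_{4k-1}}\mathrm{sgn}(\sigma)\,\{f_{\sigma(1)},\dots,f_{\sigma(2k-1)},\{f_{\sigma(2k)},\dots,f_{\sigma(4k-1)}\}\}=0$$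 for all $f_1,\dots,f_{4k-1}\in C^\infty(M)$; equivalently, it is generated by a $2k$-vector field $P$ with $[P,P]=0$, where $[\cdot,\cdot]$ is the Schouten bracket. *)

(* Defs.v *)
From HB Require Import structures.
From mathcomp Require Import all_boot all_order all_algebra perm.
From mathcomp Require Import all_classical all_reals all_analysis.
Set Implicit Arguments.
Unset Strict Implicit.
Unset Printing Implicit Defensive.
Import Order.TTheory GRing.Theory Num.Theory.
Import numFieldNormedType.Exports.
Local Open Scope classical_set_scope.
Local Open Scope ring_scope.

Section Smooth.
Context {R : realType} {V W : normedModType R}.

Fixpoint ndifferentiable_on (D : set V) (n : nat) (f : V -> W) : Prop :=
  if n is n'.+1 then
    (forall x, D x -> differentiable f x) /\
    (forall v, ndifferentiable_on D n' ('D_v f))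
  else True.
Definition smooth_on (D : set V) (f : V -> W) :=
  forall n, ndifferentiable_on D n f.

Lemma near_eq_differentiable (f g : V -> W) x :
  (\near x, f x = g x) -> differentiable f x -> differentiable g x.
Proof.
move=> fg df; pose h : V -> W := g - f.
have h0 : \forall y \near x, h y = 0.
  by near=> y; rewrite /h !fctE; apply/eqP; rewrite subr_eq0 eq_sym; apply/eqP; near: y.
have hx : h x = 0 by exact: nbhs_singleton h0.
have ho : h \o shift x = cst (h x) + (\0 : V -> W) +o_ 0 id.
  apply: eqaddoE; rewrite hx.
  have -> : cst 0 + (\0 : V -> W) = 0 by apply/funext => y; rewrite !fctE addr0.
  rewrite add0r; apply/eqoP => _/posnumP[e].
  have : \forall y \near (0 : V), h (y + x) = 0.
    by move: h0; rewrite (near_shift 0) subr0.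
  by apply: filterS => y /= ->; rewrite normr0 mulr_ge0.
have -> : g = f + h by apply/funext => y; rewrite /h !fctE addrCA subrr addr0.
apply: differentiableD => //; apply/diff_locallyP.
have -> : 'd h x = \0 :> (V -> W).
  by apply: (@diff_unique _ _ _ h \0) => // y; exact: cst_continuous.
by split => //; exact: cst_continuous.
Unshelve. all: by end_near. Qed.

Lemma eq_ndifferentiable_on (D : set V) n (f g : V -> W) : open D ->
  (forall x, D x -> f x = g x) ->
  ndifferentiable_on D n f -> ndifferentiable_on D n g.
Proof.
move=> oD; elim: n f g => //= n IH f g fg [df dDf].
have nfg x : D x -> \near x, f x = g x.
  by move=> Dx; near=> y; apply: fg; near: y; exact: open_nbhs_nbhs.
split => [x Dx|v]; first exact: near_eq_differentiable (nfg _ Dx) (df _ Dx).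
by apply: IH (dDf v) => x Dx; apply: near_eq_derive; exact: nfg.
Unshelve. all: by end_near. Qed.

Lemma ndifferentiable_onS (D : set V) n (f : V -> W) :
  ndifferentiable_on D n.+1 f -> ndifferentiable_on D n f.
Proof.
elim: n f => //= n IH f [df dDf]; split => // v; exact: IH (dDf v).
Qed.

Lemma ndifferentiable_on_cst (D : set V) n (c : W) :
  ndifferentiable_on D n (cst c).
Proof.
elim: n c => //= n IH c; split=> // v.
by have -> : 'D_v (cst c) = cst (0 : W)
  by apply/funext => x; rewrite derive_cst.
Qed.

Lemma ndifferentiable_onD (D : set V) n (f g : V -> W) : open D ->
  ndifferentiable_on D n f -> ndifferentiable_on D n g ->
  ndifferentiable_on D n (f + g).
Proof.
move=> oD; elim: n f g => //= n IH f g [df dDf] [dg dDg]; split=> [x Dx|v].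
  by apply: differentiableD; [exact: df | exact: dg].
apply: eq_ndifferentiable_on (IH _ _ (dDf v) (dDg v)) => // x Dx.
by rewrite deriveD //; apply: diff_derivable; [exact: df | exact: dg].
Qed.
End Smooth.

Lemma ndifferentiable_onM {R : realType} {V : normedModType R}
    (D : set V) n (f g : V -> R) : open D ->
  ndifferentiable_on D n f -> ndifferentiable_on D n g ->
  ndifferentiable_on D n (f * g).
Proof.
move=> oD; elim: n f g => // n IH f g nf ng.
have [[df dDf] [dg dDg]] := (nf, ng); split=> [x Dx|v].
  by apply: differentiableM; [exact: df | exact: dg].
have nf' := ndifferentiable_onS nf; have ng' := ndifferentiable_onS ng.
apply: (eq_ndifferentiable_on oD)
  (ndifferentiable_onD oD (IH _ _ nf' (dDg v)) (IH _ _ ng' (dDf v))) => x Dx.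
by rewrite deriveM //; apply: diff_derivable; [exact: df | exact: dg].
Qed.

(* The exterior algebra of 'rV[R]_m. The coefficient of a at
   S = {i_1 < ... < i_j} is that of e_{i_1} /\ ... /\ e_{i_j}. The same type
   serves for covectors (with basis dx_1, ..., dx_m) and for vectors (with the
   dual basis). *)
Section ExteriorAlgebra.
Local Open Scope set_scope.
Context {R : realType} {m : nat}.

Definition ext := {ffun {set 'I_m} -> R}.
Implicit Types (a b : ext) (S T : {set 'I_m}).

Definition ext1 : ext := [ffun S => (S == finset.set0)%:R].

Definition ext_vec (v : 'rV[R]_m) : ext :=
  [ffun S => \sum_i v 0 i *+ (S == [set i])].

Definition inversions S T : nat :=
  #|[set p : 'I_m * 'I_m | [&& p.1 \in S, p.2 \in T & (p.2 < p.1)%N]]|.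

Definition wedge a b : ext :=
  [ffun S => \sum_(T in powerset S)
     (-1) ^+ inversions T (S :\: T) * a T * b (S :\: T)].

Definition wedge_pow a (k : nat) : ext := iter k (wedge a) ext1.

Definition wedge_all (j : nat) (v : 'I_j -> 'rV[R]_m) : ext :=
  \big[wedge/ext1]_(i < j) ext_vec (v i).

(* The pairing for which <theta_1 /\ ... /\ theta_j, X_1 /\ ... /\ X_j> =
   det (theta_i (X_j)) (see ext_pair_det): the monomial bases are dual. *)
Definition ext_pair a b : R := \sum_S a S * b S.

Definition homogeneous (j : nat) a := forall S, a S != 0 -> #|S| = j.

(* The algebra morphism induced by the linear map v |-> v *m A. *)
Definition ext_map (A : 'M[R]_m) a : ext :=
  \sum_S a S *: \big[wedge/ext1]_(i in S) ext_vec (row i A).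

Definition form_matrix a : 'M[R]_m :=
  \matrix_(i, j) ext_pair a
    (wedge (ext_vec (delta_mx 0 i)) (ext_vec (delta_mx 0 j))).

(* The bivector L with L(i_X w, i_Y w) = w(X, Y): the inverse of w, with the
   sign for which \sum_j dp_j /\ dq_j has inverse \sum_j d/dp_j /\ d/dq_j
   (see ext_inv_darboux). *)
Definition ext_inv a : ext :=
  \sum_(i < m) \sum_(j < m | (i < j)%N) (invmx (form_matrix a))^T i j *:
    wedge (ext_vec (delta_mx 0 i)) (ext_vec (delta_mx 0 j)).

End ExteriorAlgebra.
Arguments ext : clear implicits.

Section ExteriorAlgebraTheory.
Local Open Scope set_scope.
Context {R : realType} {m : nat}.
Implicit Types (a b : ext R m) (S T : {set 'I_m}) (u v : 'rV[R]_m).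

(* wedge with its arguments swapped, for linearity in the left argument *)
Definition wedger a b := wedge b a.

Fact wedge_is_linear a : linear (wedge a).
Proof.
move=> k b c; apply/ffunP => S; rewrite !ffunE scaler_sumr -big_split /=.
by apply: eq_bigr => T _; rewrite !ffunE mulrDr mulrCA.
Qed.
HB.instance Definition _ a :=
  GRing.isLinear.Build R (ext R m) (ext R m) *:%R (wedge a) (wedge_is_linear a).

Fact wedger_is_linear a : linear (wedger a).
Proof.
move=> k b c; apply/ffunP => S; rewrite !ffunE scaler_sumr -big_split /=.
by apply: eq_bigr => T _; rewrite !ffunE mulrDr mulrDl mulrCA -!mulrA.
Qed.
HB.instance Definition _ a :=
  GRing.isLinear.Build R (ext R m) (ext R m) *:%R (wedger a) (wedger_is_linear a).

Fact ext_vec_is_linear : linear (@ext_vec R m).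
Proof.
move=> k u v; apply/ffunP => S; rewrite !ffunE scaler_sumr -big_split /=.
by apply: eq_bigr => i _; rewrite !mxE mulrnDl scalerMnr.
Qed.
HB.instance Definition _ :=
  GRing.isLinear.Build R 'rV[R]_m (ext R m) *:%R (@ext_vec R m) ext_vec_is_linear.

Fact ext_pair_is_linear a : linear_for *%R (ext_pair a).
Proof.
move=> k b c; rewrite /ext_pair mulr_sumr -big_split /=.
by apply: eq_bigr => S _; rewrite !ffunE mulrDr mulrCA.
Qed.
HB.instance Definition _ a :=
  GRing.isLinear.Build R (ext R m) R *%R (ext_pair a) (ext_pair_is_linear a).

Lemma ext_pairC a b : ext_pair a b = ext_pair b a.
Proof. by apply: eq_bigr => S _; rewrite mulrC. Qed.

Local Notation below i S := #|[set j in S | (j < i)%N]|.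
Local Notation vbase i := (ext_vec (delta_mx 0 i)).

Lemma ext_vec_deltaE i S : vbase i S = (S == [set i])%:R :> R.
Proof.
rewrite ffunE (bigD1 i) //= mxE !eqxx big1 ?addr0 // => j jNi.
by rewrite mxE eqxx /= (negPf jNi) mul0rn.
Qed.

Lemma ext_vecE v : ext_vec v = \sum_i v 0 i *: vbase i.
Proof. by rewrite [in LHS](row_sum_delta v) linear_sum; under eq_bigr do rewrite linearZ. Qed.

Lemma wedge_deltaE i b S :
  wedge (vbase i) b S = (i \in S)%:R * (-1) ^+ below i S * b (S :\ i).
Proof.
rewrite ffunE; have [iS|iNS] := boolP (i \in S); last first.
  rewrite !mul0r big1 // => T; rewrite inE => TS; rewrite ext_vec_deltaE.
  case: eqP => [Ti|]; last by rewrite mulr0 mul0r.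
  by move: TS; rewrite Ti finset.sub1set (negPf iNS).
rewrite (bigD1 [set i]) /=; last by rewrite inE finset.sub1set.
rewrite big1 ?addr0; last first.
  by move=> T /andP[_ /negPf TNi]; rewrite ext_vec_deltaE TNi mulr0 mul0r.
rewrite ext_vec_deltaE eqxx mulr1 mul1r; congr ((-1) ^+ _ * _).
rewrite /inversions -(card_imset [set j in S | _] (_ : injective (pair i))); last by move=> x y [].
apply: eq_card => -[x y]; rewrite !inE /=; apply/and3P/imsetP.
  by move=> [/eqP-> /andP[_ yS] yx]; exists y; rewrite // inE yS.
move=> [z]; rewrite inE => /andP[zS zi] [-> ->]; split=> //.
by rewrite zS andbT neq_ltn zi.
Qed.

(* contraction by u, the transpose of a |-> u /\ a for ext_pair *)
Definition contr u b : ext R m :=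
  [ffun T : {set _} => \sum_(i | i \notin T) u 0 i * ((-1) ^+ below i T * b (i |: T))].

Fact contr_is_linear u : linear (contr u).
Proof.
move=> k b c; apply/ffunP => S; rewrite !ffunE scaler_sumr -big_split /=.
apply: eq_bigr => i _; rewrite !ffunE !mulrDr; congr (_ + _).
by rewrite -[RHS]/(k * (u 0 i * (_ * b _))) [RHS]mulrCA [in RHS](mulrCA k).
Qed.
HB.instance Definition _ u :=
  GRing.isLinear.Build R (ext R m) (ext R m) *:%R (contr u) (contr_is_linear u).

Lemma below_setU1 i T : below i (i |: T) = below i T.
Proof.
by apply: eq_card => j; rewrite !inE; case: eqP => // ->; rewrite ltnn !andbF.
Qed.

Lemma ext_pair_wedge u a b :
  ext_pair (wedge (ext_vec u) a) b = ext_pair a (contr u b).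
Proof.
rewrite ext_vecE -[wedge _ a]/(wedger a _) linear_sum /=.
rewrite ext_pairC linear_sum /= [RHS]/ext_pair.
under [RHS]eq_bigr do rewrite ffunE mulr_sumr.
rewrite [RHS](exchange_big_dep xpredT) //=; apply: eq_bigr => i _.
rewrite linearZ linearZ /= /ext_pair mulr_sumr.
rewrite (bigID (fun S : {set 'I_m} => i \in S)) /= [X in _ + X]big1 ?addr0; last first.
  by move=> S iNS; rewrite /wedger wedge_deltaE (negPf iNS) !mul0r !mulr0.
rewrite (reindex_onto (fun T => i |: T) (fun S => S :\ i)) /=; last first.
  by move=> S iS; rewrite finset.setD1K.
rewrite (eq_bigl (fun T => i \notin T)); last first.
  move=> T; rewrite finset.setU11 /=; apply/eqP/idP => [<-|iNT]; first by rewrite !inE eqxx.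
  by rewrite finset.setU1K.
apply: eq_bigr => T iNT; rewrite /wedger wedge_deltaE finset.setU11.
rewrite mul1r below_setU1 finset.setU1K //.
by rewrite [RHS]mulrCA; congr (_ * _); rewrite [LHS]mulrCA [RHS]mulrCA [b _ * a _]mulrC.
Qed.

Lemma contr_deltaE i b T :
  contr (delta_mx 0 i) b T = (i \notin T)%:R * (-1) ^+ below i T * b (i |: T).
Proof.
rewrite ffunE; have [iT|iNT] := boolP (i \notin T).
  rewrite (bigD1 i) //= mxE !eqxx big1 ?addr0 ?mul1r ?mulrA ?mul1r // => j /andP[_ jNi].
  by rewrite mxE eqxx /= (negPf jNi) mul0r.
rewrite !mul0r big1 // => j jT; rewrite mxE eqxx /=.
by case: eqP => [ji|]; rewrite ?mul0r // -ji jT in iNT *.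
Qed.

Lemma contr_wedge_delta i j b : contr (delta_mx 0 i) (wedge (vbase j) b) =
  (i == j)%:R *: b - wedge (vbase j) (contr (delta_mx 0 i) b).
Proof.
apply/ffunP => T; rewrite contr_deltaE wedge_deltaE [RHS]ffunE [X in _ = _ + X]ffunE.
rewrite [X in _ = X - _]ffunE wedge_deltaE contr_deltaE !inE.
have [<-|iNj] := eqVneq i j.
  rewrite /= !mul1r below_setU1.
  have [iT|iNT] := boolP (i \in T); rewrite ?mul0r ?mul1r ?subr0.
    rewrite scale1r finset.setD1K //.
    have -> : below i T = below i (T :\ i) by rewrite -{1}(finset.setD1K iT) below_setU1.
    by rewrite mulrA -expr2 sqrr_sign mul1r subrr.
  by rewrite scale1r finset.setU1K // mulrA -expr2 sqrr_sign mul1r.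
rewrite /= scale0r sub0r.
have [jT|jNT] := boolP (j \in T); last by rewrite !mul0r mulr0 oppr0.
have [iT|iNT] := boolP (i \in T).
  by rewrite /= !mul0r mulr0 oppr0.
rewrite /= !mul1r.
have -> : (i |: T) :\ j = i |: (T :\ j).
  by apply/finset.setP => k; rewrite !inE; case: (eqVneq k i) => // ->; rewrite iNj.
rewrite !mulrA -mulNr; congr (_ * _).
have -> : below j (i |: T) = ((i < j) + below j T)%N.
  have [ij|ji] := ltnP i j.
    have := cardsU1 i [set k in T | (k < j)%N]; rewrite inE (negPf iNT) /= => <-.
    by apply: eq_card => k; rewrite !inE; case: eqP => // ->; rewrite ij.
  apply: eq_card => k; rewrite !inE; case: eqP => // ->.
  by rewrite ltnNge ji (negPf iNT).
have -> : below i T = ((j < i) + below i (T :\ j))%N.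
  have [ji|ij] := ltnP j i.
    have := cardsU1 j [set k in T :\ j | (k < i)%N]; rewrite !inE eqxx /= => <-.
    by apply: eq_card => k; rewrite !inE; case: eqP => // ->; rewrite ji jT.
  apply: eq_card => k; rewrite !inE; case: eqP => // ->.
  by rewrite ltnNge ij andbF.
rewrite !exprD.
have : (-1) ^+ (i < j)%N * (-1) ^+ (j < i)%N = -1 :> R.
  by move: iNj; rewrite -val_eqE /=; case: ltngtP => // _ _; rewrite ?mulr1 ?mul1r.
move: ((-1) ^+ (i < j)%N) ((-1) ^+ (j < i)%N) => s t st.
by rewrite mulrACA [t * s]mulrC st mulN1r mulrC.
Qed.

Lemma contr_wedge u v b : contr u (wedge (ext_vec v) b) =
  (u *m v^T) 0 0 *: b - wedge (ext_vec v) (contr u b).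
Proof.
have contrE w c : contr w c = \sum_i w 0 i *: contr (delta_mx 0 i) c.
  apply/ffunP => T; rewrite ffunE sum_ffunE big_mkcond /=; apply: eq_bigr => i _.
  rewrite [RHS]ffunE contr_deltaE.
  by case: ifP => _; rewrite ?mul1r // !mul0r scaler0.
rewrite !(contrE u) (ext_vecE v) linear_sum mxE scaler_suml -sumrB.
apply: eq_bigr => i _; rewrite linearZ /= -scalerA -scalerBr; congr (_ *: _).
rewrite -[wedge _ b]/(wedger b _) -[wedge _ (contr _ _)]/(wedger (contr _ _) _).
rewrite !linear_sum mxE /= sumrN.
under eq_bigr do rewrite !linearZ /= /wedger contr_wedge_delta scalerBr.
rewrite sumrB; congr (_ - _); last by apply: eq_bigr => k _; rewrite linearZ.
rewrite (bigD1 i) //= eqxx scale1r big1 ?addr0 // => k kNi.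
by rewrite eq_sym (negPf kNi) scale0r scaler0.
Qed.

Lemma contr_wedge_all n u (v : 'I_n.+1 -> 'rV[R]_m) : contr u (wedge_all v) =
  \sum_(i < n.+1) ((-1) ^+ i * (u *m (v i)^T) 0 0) *: wedge_all (v \o lift i).
Proof.
elim: n v => [|n IH] v; rewrite /wedge_all big_ord_recl
  -[X in wedge _ X]/(wedge_all (fun i => v (lift ord0 i))).
  rewrite contr_wedge big_ord_recl big_ord0 /= expr0 mul1r addr0.
  rewrite /wedge_all !big_ord0 (_ : contr u ext1 = 0) ?linear0 ?subr0 ?addr0 //.
  apply/ffunP => T; rewrite [LHS]ffunE [RHS]ffunE big1 // => i iT; rewrite ffunE.
  by rewrite -cards_eq0 cardsU1 iT !mulr0.
rewrite contr_wedge IH [RHS]big_ord_recl expr0 mul1r linear_sum -sumrN.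
congr (_ + _); apply: eq_bigr => i _.
rewrite linearZ -scaleNr lift0 exprS mulN1r mulNr; congr (_ *: _).
rewrite big_ord_recl /wedge_all /=; congr wedge; first by congr (ext_vec (v _)); apply/val_inj.
apply: eq_bigr => k _ /=; congr (ext_vec (v _)); apply: val_inj => /=.
by rewrite /bump /= !add1n ltnS addnS.
Qed.

Lemma ext_pair_det n (t v : 'I_n -> 'rV[R]_m) :
  ext_pair (wedge_all t) (wedge_all v) =
  \det (\matrix_(i, j) (t i *m (v j)^T) 0 0).
Proof.
elim: n t v => [|n IH] t v.
  rewrite det_mx00 /wedge_all !big_ord0 /ext_pair (bigD1 finset.set0) //=.
  rewrite !ffunE eqxx mul1r big1 ?addr0 // => S /negPf SN0.
  by rewrite !ffunE SN0 mul0r.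
rewrite {1}/wedge_all big_ord_recl ext_pair_wedge contr_wedge_all linear_sum.
rewrite (expand_det_row _ ord0); apply: eq_bigr => j _.
rewrite linearZ /= -[X in ext_pair X]/(wedge_all (fun i => t (lift ord0 i))) IH.
rewrite mxE /cofactor add0n [RHS]mulrCA mulrA; congr (_ * \det _).
by apply/matrixP => i k; rewrite !mxE.
Qed.

Lemma wedger1 a : wedge a ext1 = a.
Proof.
apply/ffunP => S; rewrite ffunE (bigD1 S) /= ?inE //.
rewrite ffunE finset.setDv eqxx mulr1 /inversions.
rewrite [X in (-1) ^+ X](_ : _ = 0%N) ?mul1r; last first.
  by apply/eqP; rewrite cards_eq0; apply/eqP/finset.setP => x; rewrite !inE andbF.
rewrite big1 ?addr0 // => T; rewrite inE => /andP[TS TNS].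
rewrite ffunE finset.setD_eq0; case: (boolP (S \subset T)) => ST; last by rewrite mulr0.
by case/eqP: TNS; apply/eqP; rewrite finset.eqEsubset TS.
Qed.

Lemma ext_pair_wedge2 (u v x y : 'rV[R]_m) :
  ext_pair (wedge (ext_vec u) (ext_vec v)) (wedge (ext_vec x) (ext_vec y)) =
  (u *m x^T) 0 0 * (v *m y^T) 0 0 - (u *m y^T) 0 0 * (v *m x^T) 0 0.
Proof.
have := ext_pair_det (fun i : 'I_2 => if i == 0 then u else v)
  (fun i : 'I_2 => if i == 0 then x else y).
rewrite /wedge_all !big_ord_recl !big_ord0 !wedger1 /= => ->.
rewrite (expand_det_row _ ord0) !big_ord_recl big_ord0 /cofactor !det_mx11.
by rewrite !mxE /= addr0 expr0 expr1 mul1r mulN1r mulrN.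
Qed.
End ExteriorAlgebraTheory.

Lemma delta_mx_dot {R : realType} {m} (i j : 'I_m) :
  ((delta_mx 0 i : 'rV[R]_m) *m (delta_mx 0 j : 'rV[R]_m)^T) 0 0 = (i == j)%:R.
Proof. by rewrite trmx_delta -rowE !mxE eqxx andbT. Qed.

Lemma ext_inv_darboux {R : realType} (n : nat) :
  let w : ext R (n + n) := \sum_(j < n)
    wedge (ext_vec (delta_mx 0 (lshift n j))) (ext_vec (delta_mx 0 (rshift n j))) in
  ext_inv w = w.
Proof.
move=> w; have wE : form_matrix w = block_mx 0 1%:M (- 1%:M) 0.
  apply/matrixP => i j; rewrite mxE ext_pairC linear_sum /=.
  under eq_bigr do rewrite ext_pair_wedge2 !delta_mx_dot.
  rewrite -(fintype.splitK i) -(fintype.splitK j).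
  case: (fintype.split i) => i'; case: (fintype.split j) => j' /=.
  - rewrite block_mxEul mxE big1 // => k _.
    by rewrite !eq_lrshift mulr0 mul0r subrr.
  - rewrite block_mxEur mxE (bigD1 i') //= eq_lshift eqxx mul1r eq_lrshift.
    rewrite mul0r subr0 eq_rshift [j' == i']eq_sym big1 ?addr0 // => k kNi.
    by rewrite eq_lshift [i' == k]eq_sym (negPf kNi) eq_lrshift !mul0r subr0.
  - rewrite block_mxEdl !mxE (bigD1 i') //= eq_rlshift mul0r sub0r.
    rewrite eq_rshift eqxx mul1r eq_lshift [j' == i']eq_sym big1 ?addr0 // => k kNi.
    by rewrite !eq_rlshift eq_rshift [i' == k]eq_sym (negPf kNi) !mul0r subr0.
  - rewrite block_mxEdr mxE big1 // => k _.
    by rewrite !eq_rlshift mul0r mulr0 subrr.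
have wV : (invmx (form_matrix w))^T = form_matrix w.
  have wwT : form_matrix w *m (form_matrix w)^T = 1%:M.
    rewrite wE tr_block_mx mulmx_block !trmx0 trmx1 linearN /= trmx1.
    by rewrite !mul0mx !mulmx0 !mulNmx !mulmxN !mulmx1 opprK !add0r !addr0 -scalar_mx_block.
  have [wU _] := mulmx1_unit wwT.
  by rewrite -[invmx _]mulmx1 -wwT mulKmx // trmxK.
rewrite /ext_inv wV wE big_split_ord /= [X in _ + X]big1 ?addr0 => [|i _].
  apply: eq_bigr => i _; rewrite big_split_ord /= big1 ?add0r => [|j _].
    rewrite (bigD1 i) /= ?ltn_addr // block_mxEur mxE eqxx scale1r.
    rewrite big1 ?addr0 // => j /andP[_ jNi].
    by rewrite block_mxEur mxE eq_sym (negPf jNi) scale0r.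
  by rewrite block_mxEul mxE scale0r.
rewrite big_split_ord /= big_pred0 => [|j].
  by rewrite add0r big1 // => j _; rewrite block_mxEdr mxE scale0r.
by rewrite ltnNge ltnW ?ltn_addr.
Qed.

Record chart (R : realType) (m : nat) (T : topologicalType) := Chart {
  chart_dom : set T;
  chart_map :> T -> 'rV[R]_m;
  chart_inv : 'rV[R]_m -> T;
  open_chart_dom : open chart_dom;
  open_chart_img : open (chart_map @` chart_dom);
  chart_map_continuous : {within chart_dom, continuous chart_map};
  chart_inv_continuous : {within chart_map @` chart_dom, continuous chart_inv};
  chart_mapK : forall p, chart_dom p -> chart_inv (chart_map p) = p
}.

Arguments open_chart_dom {R m T} c.
Arguments open_chart_img {R m T} c.

Definition chart_img R m T (c : chart R m T) : set 'rV[R]_m :=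
  c @` chart_dom c.

Record manifold (R : realType) (m : nat) := Manifold {
  manifold_sort :> topologicalType;
  manifold_hausdorff : hausdorff_space manifold_sort;
  manifold_second_countable : @second_countable manifold_sort;
  atlas : set (chart R m manifold_sort);
  atlas_cover : forall p, exists2 c, atlas c & chart_dom c p;
  atlas_smooth : forall c c', atlas c -> atlas c' ->
    smooth_on (c @` (chart_dom c `&` chart_dom c')) (c' \o chart_inv c)
}.

Arguments atlas {R m} M : rename.

Section Manifold.
Context {R : realType} {m : nat} (M : manifold R m).

Definition smooth_fun : {pred M -> R} := [pred f | `[< forall c, atlas M c ->
  smooth_on (chart_img c) (f \o chart_inv c) >]].

Lemma smooth_funP (f : M -> R) :
  reflect (forall c, atlas M c ->
             smooth_on (chart_img c) (f \o chart_inv c))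
          (f \in smooth_fun).
Proof. exact: asboolP. Qed.

Fact smooth_fun_subring_closed : subring_closed smooth_fun.
Proof.
have sN (f : M -> R) : f \in smooth_fun -> - f \in smooth_fun.
  move=> /smooth_funP sf; apply/smooth_funP => c ac n.
  have := ndifferentiable_onM (open_chart_img c)
    (ndifferentiable_on_cst (chart_img c) n (-1 : R)) (sf c ac n).
  by congr ndifferentiable_on; apply/funext => x; rewrite /= !fctE mulN1r.
split=> [|f g sf /sN sg|f g sf sg]; apply/smooth_funP => c ac n.
- exact: ndifferentiable_on_cst.
- exact: (ndifferentiable_onD (open_chart_img c)
    (smooth_funP _ sf c ac n) (smooth_funP _ sg c ac n)).
- exact: (ndifferentiable_onM (open_chart_img c)
    (smooth_funP _ sf c ac n) (smooth_funP _ sg c ac n)).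
Qed.

Fact smooth_fun_scaler_closed : GRing.scaler_closed smooth_fun.
Proof.
move=> k f sf; apply/smooth_funP => c ac n.
exact: (ndifferentiable_onM (open_chart_img c)
  (ndifferentiable_on_cst (chart_img c) n k) (smooth_funP _ sf c ac n)).
Qed.

HB.instance Definition _ :=
  GRing.isSubringClosed.Build (M -> R) smooth_fun smooth_fun_subring_closed.
HB.instance Definition _ :=
  GRing.isScaleClosed.Build R (M -> R) smooth_fun smooth_fun_scaler_closed.

(* C^oo(M), as a subring and an R-submodule of M -> R *)
Record Cinf := MkCinf { Cinf_val :> M -> R; _ : Cinf_val \in smooth_fun }.
HB.instance Definition _ := [isSub for Cinf_val].
HB.instance Definition _ := [Choice of Cinf by <:].
HB.instance Definition _ := GRing.SubChoice_isSubComPzRing.Build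
  (M -> R) smooth_fun Cinf (subringClosedP _).
HB.instance Definition _ := [SubZmodule_isSubLmodule of Cinf by <:].

(* Tensor fields are given by their components in the charts of the atlas;
   [a c x] is meaningful only for c in the atlas and x in the image of c. *)
Definition ext_field := chart R m M -> 'rV[R]_m -> ext R m.

Definition smooth_ext_field (j : nat) (a : ext_field) :=
  forall c, atlas M c ->
    (forall x, chart_img c x -> homogeneous j (a c x)) /\
    (forall S, smooth_on (chart_img c) (fun x => a c x S)).

Definition transition_jacobian (c c' : chart R m M) (p : M) : 'M[R]_m :=
  'J (c' \o chart_inv c) (c p).

(* Row i of the Jacobian is the image of the i-th coordinate vector, so vectors
   are pushed forward by v |-> v *m J, and covectors pulled back by J^T. *)
Definition multivector_field (j : nat) (P : ext_field) :=
  smooth_ext_field j P /\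
  forall c c' p, atlas M c -> atlas M c' ->
    chart_dom c p -> chart_dom c' p ->
    P c' (c' p) = ext_map (transition_jacobian c c' p) (P c (c p)).

Definition differential_form (j : nat) (a : ext_field) :=
  smooth_ext_field j a /\
  forall c c' p, atlas M c -> atlas M c' ->
    chart_dom c p -> chart_dom c' p ->
    a c (c p) = ext_map (transition_jacobian c c' p)^T (a c' (c' p)).

Definition exterior_derivative (a : ext_field) : ext_field := fun c x =>
  \sum_(i < m) wedge (ext_vec (delta_mx 0 i))
    [ffun S => 'D_(delta_mx 0 i) (fun y => a c y S) x].

Definition gradient (f : M -> R) (c : chart R m M) (x : 'rV[R]_m) : 'rV[R]_m :=
  \row_i 'D_(delta_mx 0 i) (f \o chart_inv c) x.

Definition wedge_differentials (j : nat) (f : 'I_j -> M -> R) : ext_field :=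
  fun c x => wedge_all (fun i => gradient (f i) c x).

Definition generated_by (j : nat) (br : ('I_j -> Cinf) -> Cinf)
    (P : ext_field) :=
  multivector_field j P /\
  forall (f : 'I_j -> Cinf) c p, atlas M c -> chart_dom c p ->
    br f p = ext_pair (wedge_differentials f c (c p)) (P c (c p)).

End Manifold.

Section GeneralizedPoisson.
Context {R : realType} {m : nat} {M : manifold R m} (r : nat).
Implicit Types (br : ('I_r -> Cinf M) -> Cinf M) (f : 'I_r -> Cinf M).

Definition bracket_linear br := forall f i (a : R) (g h : Cinf M),
  br [eta f with i |-> a *: g + h] =
  a *: br [eta f with i |-> g] + br [eta f with i |-> h].

Definition bracket_antisymmetric br := forall f (s : 'S_r),
  br (f \o s) = (-1) ^+ s * br f.

Definition bracket_leibniz br := forall f i (g h : Cinf M),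
  br [eta f with i |-> g * h] =
  g * br [eta f with i |-> h] + br [eta f with i |-> g] * h.

(* {f_0, ..., f_{r-2}, {f_{r-1}, ..., f_{2r-2}}} *)
Definition nested_bracket br (f : 'I_(r.-1 + r) -> Cinf M) : Cinf M :=
  br (fun i : 'I_r =>
    if insub (val i) is Some i' then f (lshift r i')
    else br (fun j => f (rshift r.-1 j))).

Definition bracket_jacobi br := forall f : 'I_(r.-1 + r) -> Cinf M,
  \sum_(s : 'S_(r.-1 + r)) (-1) ^+ s * nested_bracket br (f \o s) = 0.

Definition poisson_bracket br :=
  [/\ bracket_linear br, bracket_antisymmetric br, bracket_leibniz br
    & bracket_jacobi br].

End GeneralizedPoisson.

Record symplectic_form (R : realType) (m : nat) (M : manifold R m) :=
  SymplecticForm {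
  symplectic_field : ext_field M;
  symplectic_differential_form : differential_form 2 symplectic_field;
  symplectic_closed : forall c x, atlas M c -> chart_img c x ->
    exterior_derivative symplectic_field c x = 0;
  symplectic_nondegenerate : forall c x, atlas M c -> chart_img c x ->
    form_matrix (symplectic_field c x) \in unitmx
}.

Section Symplectic.
Context {R : realType} {n : nat} {M : manifold R n.*2}.
Variable w : symplectic_form M.

Definition poisson_tensor : ext_field M := fun c x => ext_inv (symplectic_field w c x).

Definition poisson_tensor_pow (k : nat) : ext_field M :=
  fun c x => wedge_pow (poisson_tensor c x) k.

Definition symplectic_bracket (k : nat)
    (br : ('I_k.*2 -> Cinf M) -> Cinf M) :=
  forall (f : 'I_k.*2 -> Cinf M) c p, atlas M c -> chart_dom c p ->
    br f p *: ((n`!)%:R^-1 *: wedge_pow (symplectic_field w c (c p)) n) =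
    k`!%:R *: wedge (wedge_differentials f c (c p))
      (((n - k)`!)%:R^-1 *: wedge_pow (symplectic_field w c (c p)) (n - k)).

End Symplectic.
Arguments poisson_tensor_pow {R n M} w k c x.
Arguments symplectic_bracket {R n M} w k br.

(* Main.v *)
Require Import Defs.
From HB Require Import structures.
From mathcomp Require Import all_boot all_order all_algebra perm.
From mathcomp Require Import all_classical all_reals all_analysis.
From mathcomp Require Import ring lra.
Set Implicit Arguments.
Unset Strict Implicit.
Unset Printing Implicit Defensive.
Import Order.TTheory GRing.Theory Num.Theory.
Import numFieldNormedType.Exports.
Local Open Scope classical_set_scope.
Local Open Scope ring_scope.

(** Write L for the Poisson tensor. All the brackets are computed from the
    numbers L(u, v) on covectors u and v.

    The pairing of v_1 /\ ... /\ v_2k with L^k satisfies the expansion of a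
    Pfaffian along its first row ([ext_pair_wedge_pow_rec]), because contraction
    is a derivation of even elements. The Liouville identity
    ([wedge_all_form_pow]) says that k! v_1 /\ ... /\ v_2k /\ w^(n-k) / (n-k)!
    is this pairing times w^n / n!; it follows by showing that the left side
    obeys the same recursion. Let Y be the vector dual to v_1 under w. The form
    v_2 /\ ... /\ v_2k /\ w^(n-k+1) vanishes for reasons of degree, and
    contracting it with Y gives the recursion. For k = n the identity shows that
    w^n has no zero, whence the uniqueness of the bracket.

    The recursion also shows that the pairing with L^k depends only on the
    matrix of the L(v_i, v_j) ([ext_pair_wedge_pow_eq]). This gives the
    transformation law of L^k under changes of charts, hence a well defined
    bracket, which is multilinear, alternating and a derivation like any bracket
    generated by a multivector field.

    The generalized Jacobi identity is reduced to the Jacobi identity of the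
    2-bracket, with no recourse to Darboux coordinates. The latter
    ([flat_jacobi]) follows in any chart from d w = 0 and the symmetry of second
    derivatives ([derive_comm]). Given functions f_1, ..., f_N with N = 4k-1,
    introduce an auxiliary space with basis e_1, ..., e_N and on it the bivector
    G with coefficients {f_i, f_j}. The 2k-brackets of these functions are then
    coefficients of G^k, and a nested bracket is, up to a constant, the sum over
    a of a coefficient of e_a /\ G^(k-1) times a coefficient of
    dG_a /\ G^(k-1), where dG_a has coefficients {f_a, {f_i, f_j}}
    ([nested_flat_bracket]). Alternating over all permutations wedges the two
    factors together ([ext_pair_shuffle]). The result contains the factor
    sum_a e_a /\ dG_a, whose coefficients are the cyclic sums of the
    {f_i, {f_j, f_l}} and therefore vanish. *)

(** * The exterior algebra: associativity, grading *)

Section WedgeAlgebra.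
Local Open Scope set_scope.
Context {R : realType} {m : nat}.
Implicit Types (a b c : ext R m) (S T U V : {set 'I_m}) (u v : 'rV[R]_m).

Lemma inversions_setUl S T U : [disjoint S & T]%B ->
  inversions (S :|: T) U = (inversions S U + inversions T U)%N.
Proof.
move=> dST; rewrite /inversions.
rewrite -[RHS]cardsUI [X in (_ + X)%N]eq_card0 ?addn0; last first.
  move=> -[x y]; rewrite !inE /=; apply/negP => /andP[/and3P[xS _ _] /and3P[xT _ _]].
  by move/pred0P: dST => /(_ x); rewrite /= xS xT.
by apply: eq_card => -[x y]; rewrite !inE /= andb_orl.
Qed.

Lemma inversions_setUr S T U : [disjoint S & T]%B ->
  inversions U (S :|: T) = (inversions U S + inversions U T)%N.
Proof.
move=> dST; rewrite /inversions.
rewrite -[RHS]cardsUI [X in (_ + X)%N]eq_card0 ?addn0; last first.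
  move=> -[x y]; rewrite !inE /=; apply/negP => /andP[/and3P[_ xS _] /and3P[_ xT _]].
  by move/pred0P: dST => /(_ y); rewrite /= xS xT.
by apply: eq_card => -[x y]; rewrite !inE /= andb_orl andb_orr.
Qed.

(** A pair (x, y) with x in S and y in T is counted by the first term if y < x
    and by the second if x < y. *)
Lemma inversions_swap S T : [disjoint S & T]%B ->
  (inversions S T + inversions T S = #|S| * #|T|)%N.
Proof.
move=> dST; rewrite -cardsX /inversions.
have swapI : injective (fun p : 'I_m * 'I_m => (p.2, p.1)).
  by move=> [x y] [x' y'] [-> ->].
rewrite -(card_imset [set p | [&& p.1 \in T, p.2 \in S & _]] swapI) -cardsUI.
rewrite [X in (_ + X)%N]eq_card0 ?addn0; last first.
  move=> -[x y]; rewrite !inE /=; apply/negP => /andP[/and3P[_ _ yx]].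
  case/imsetP=> -[x' y']; rewrite inE /= => /and3P[_ _ y'x'] [xE yE].
  by rewrite xE yE ltnNge ltnW in yx.
apply: eq_card => -[x y]; rewrite !inE /=; apply/orP/andP.
  case=> [/and3P[-> ->] //|/imsetP[[x' y']]].
  by rewrite inE /= => /and3P[? ? _] [-> ->].
move=> [xS yT]; have [yx|xy|xy] := ltngtP y x; first by left; rewrite xS yT.
  by right; apply/imsetP; exists (y, x) => //; rewrite inE /= xS yT.
move/pred0P: dST => /(_ x); rewrite /= xS /=.
by rewrite (_ : x = y) ?yT //; apply: val_inj.
Qed.

(** Both triple products are sums over the splittings of S into three parts
    U, V, W; the signs agree because [inversions] is additive over disjoint
    unions in either argument. *)
Lemma wedgeA : associative (@wedge R m).
Proof.
move=> a b c; apply/ffunP => S; rewrite [LHS]ffunE [RHS]ffunE.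
under eq_bigr do rewrite ffunE mulr_sumr.
under [RHS]eq_bigr do rewrite ffunE mulr_sumr mulr_suml.
rewrite [RHS](exchange_big_dep (fun U => U \in powerset S)) /=; last first.
  by move=> T U; rewrite !inE => TS UT; exact: fintype.subset_trans UT TS.
apply: eq_bigr => U; rewrite inE => US.
(* On the right T is the union of the first two parts, U and V. *)
rewrite [RHS](reindex_onto (fun V => U :|: V) (fun T => T :\: U)) /=; last first.
  move=> T /andP[_]; rewrite inE => UT.
  by rewrite finset.setDE finset.setUIr finset.setUCr finset.setIT; apply/finset.setUidPr.
apply: eq_big => [V|V].
  rewrite !inE finset.subUset US finset.subsetUl /= andbT finset.setDUl finset.setDv finset.set0U.
  by rewrite finset.subsetD; congr (_ && _); apply/idP/eqP => /finset.setDidPl.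
rewrite inE finset.subsetD => /andP[VS VU].
have UV : [disjoint U & V]%B by rewrite fintype.disjoint_sym.
have -> : (U :|: V) :\: U = V.
  by rewrite finset.setDUl finset.setDv finset.set0U; apply/finset.setDidPl.
rewrite -finset.setDDl; set W := (S :\: U) :\: V.
have VW : [disjoint V & W]%B.
  by rewrite -finset.setI_eq0 /W; apply/eqP/finset.setP => x; rewrite !inE; case: (x \in V); rewrite ?andbF.
have -> : S :\: U = V :|: W.
  apply/finset.setP => x; rewrite !inE; case: (boolP (x \in V)) => //= xV.
  by rewrite (fintype.subsetP VS) //; rewrite (disjointFr VU xV).
rewrite (inversions_setUr _ VW) (inversions_setUl _ UV) !exprD.
by ring.
Qed.

Lemma wedge1l : left_id ext1 (@wedge R m).
Proof.
move=> a; apply/ffunP => S; rewrite ffunE (bigD1 finset.set0) /= ?inE ?finset.sub0set //.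
rewrite ffunE eqxx mulr1 finset.setD0 /inversions.
rewrite eq_card0 ?mul1r => [|x]; last by rewrite !inE.
by rewrite big1 ?addr0 // => T /andP[_ /negPf T0]; rewrite ffunE T0 mulr0 mul0r.
Qed.

HB.instance Definition _ :=
  Monoid.isLaw.Build (ext R m) ext1 wedge wedgeA wedge1l wedger1.

Lemma wedgeDl a b c : wedge (a + b) c = wedge a c + wedge b c.
Proof. exact: (linearD (wedger c)). Qed.

Lemma wedgeZl (k : R) a b : wedge (k *: a) b = k *: wedge a b.
Proof. by rewrite -!/(wedger b _) linearZ. Qed.

Lemma wedge0l a : wedge 0 a = 0.
Proof. exact: (linear0 (wedger a)). Qed.

Lemma wedgeNl a b : wedge (- a) b = - wedge a b.
Proof. exact: (linearN (wedger b)). Qed.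

Lemma wedge_suml (I : Type) (r : seq I) (P : pred I) (F : I -> ext R m) b :
  wedge (\sum_(i <- r | P i) F i) b = \sum_(i <- r | P i) wedge (F i) b.
Proof. exact: (linear_sum (wedger b)). Qed.

Lemma wedgeC i j a b : homogeneous i a -> homogeneous j b ->
  wedge a b = (-1) ^+ (i * j) *: wedge b a.
Proof.
move=> ha hb; apply/ffunP => S; rewrite [RHS]ffunE !ffunE scaler_sumr.
rewrite (reindex_onto (fun T => S :\: T) (fun T => S :\: T)) /=; last first.
  by move=> T; rewrite inE => /finset.setIidPr TS; rewrite finset.setDDr finset.setDv finset.set0U.
apply: eq_big => [T|T].
  rewrite !inE finset.subsetDl /= finset.setDDr finset.setDv finset.set0U.
  by apply/eqP/idP => [<-|/finset.setIidPr//]; exact: finset.subsetIl.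
rewrite inE => /andP[_ /eqP ->].
have [aT|aT] := eqVneq (a (S :\: T)) 0; first by rewrite aT mulr0 !mul0r mulr0 scaler0.
have [bT|bT] := eqVneq (b T) 0; first by rewrite bT mulr0 mulr0 mul0r scaler0.
have dTS : [disjoint T & S :\: T]%B.
  by rewrite -finset.setI_eq0; apply/eqP/finset.setP => x; rewrite !inE; case: (x \in T); rewrite ?andbF.
have := inversions_swap dTS; rewrite (hb _ bT) (ha _ aT) mulnC => <-.
rewrite exprD -[_ *: _]/(_ * _).
have := sqrr_sign R (inversions T (S :\: T)); rewrite expr2.
move: ((-1) ^+ _) => s ss.
transitivity ((s * s) * (-1) ^+ inversions (S :\: T) T * a (S :\: T) * b T); last by ring.
by rewrite ss mul1r.
Qed.

Lemma homogeneous_vec u : homogeneous 1 (ext_vec u).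
Proof.
move=> S; apply: contraNeq => S1; rewrite ffunE big1 // => i _.
by case: eqP => // SE; rewrite SE cards1 in S1.
Qed.

Lemma homogeneous1 : homogeneous 0 (ext1 : ext R m).
Proof.
move=> S; rewrite ffunE; have [->|_] := eqVneq S finset.set0; first by rewrite cards0.
by rewrite eqxx.
Qed.

Lemma homogeneous_wedge i j a b :
  homogeneous i a -> homogeneous j b -> homogeneous (i + j) (wedge a b).
Proof.
move=> ha hb S; apply: contraNeq => Sij; rewrite ffunE big1 // => T; rewrite inE => TS.
have [aT|/ha aT] := eqVneq (a T) 0; first by rewrite aT mulr0 mul0r.
have [->|/hb bT] := eqVneq (b (S :\: T)) 0; first by rewrite mulr0.
by case/eqP: Sij; rewrite -aT -bT -(cardsID T S); congr (_ + _)%N; congr #|pred_of_set _|; apply/finset.setIidPr.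
Qed.

Lemma homogeneous_lincomb j (I : Type) (r : seq I) (P : pred I) (k : I -> R)
    (F : I -> ext R m) : (forall i, P i -> homogeneous j (F i)) ->
  homogeneous j (\sum_(i <- r | P i) k i *: F i).
Proof.
move=> hF S; apply: contraNeq => Sj; rewrite sum_ffunE big1 // => i Pi.
rewrite ffunE; case: (eqVneq (F i S) 0) => [->|/(hF i Pi) Sj']; first by rewrite scaler0.
by rewrite Sj' eqxx in Sj.
Qed.

Lemma homogeneous_wedge_all j (v : 'I_j -> 'rV[R]_m) : homogeneous j (wedge_all v).
Proof.
elim: j v => [|j IH] v; rewrite /wedge_all; first by rewrite big_ord0; exact: homogeneous1.
rewrite big_ord_recl; apply: (@homogeneous_wedge 1 j); first exact: homogeneous_vec.
exact: (IH (fun i => v (lift ord0 i))).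
Qed.

Lemma homogeneous_wedge_pow a j : homogeneous 2 a -> homogeneous j.*2 (wedge_pow a j).
Proof.
move=> ha; elim: j => [|j IH]; first exact: homogeneous1.
by rewrite doubleS -add2n; exact: homogeneous_wedge.
Qed.

Lemma homogeneous_gt j a : (m < j)%N -> homogeneous j a -> a = 0.
Proof.
move=> mj ha; apply/ffunP => S; rewrite ffunE; apply/eqP; apply/negPn/negP => /ha SE.
by have := max_card (mem S); rewrite card_ord SE leqNgt mj.
Qed.

End WedgeAlgebra.

(* [homogeneous] unfolds to a product, so its last two arguments would
   otherwise become implicit. *)
Arguments homogeneous_vec {R m} u S _.
Arguments homogeneous1 {R m} S _.
Arguments homogeneous_wedge {R m i j a b} _ _ S _.
Arguments homogeneous_wedge_all {R m j} v S _.
Arguments homogeneous_wedge_pow {R m a} j _ S _.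

(** * Monomials, minors and contractions *)

Section MonomialBasis.
Local Open Scope set_scope.
Context {R : realType} {m : nat}.
Implicit Types (a b c : ext R m) (S T : {set 'I_m}) (u v : 'rV[R]_m).

Local Notation vbase i := (ext_vec (delta_mx 0 i : 'rV[R]_m)).

(** Multiplying by a basis vector that comes before all the others creates no
    inversion. *)
Lemma wedge_sorted_delta (s : seq 'I_m) : sorted (fun i j : 'I_m => i < j)%N s ->
  \big[wedge/ext1]_(i <- s) vbase i = [ffun T : {set _} => (T == [set i in s])%:R].
Proof.
elim: s => [|x s IH] xs.
  by rewrite big_nil; apply/ffunP => T; rewrite !ffunE.
have lt_trans : transitive (fun i j : 'I_m => i < j)%N by move=> ? ? ?; exact: ltn_trans.
have [xall sorted_s] := andP (etrans (esym (path_sortedE lt_trans x s)) xs).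
rewrite big_cons IH //; apply/ffunP => T; rewrite wedge_deltaE !ffunE.
have xNs : x \notin s by apply/negP => /(allP xall); rewrite ltnn.
have [TE|TN] := eqVneq T [set i in x :: s].
  rewrite TE inE mem_head mul1r (_ : _ :\ x = [set i in s]); last first.
    apply/finset.setP => i; rewrite !inE.
    by case: (eqVneq i x) => [->|]; rewrite ?(negPf xNs).
  rewrite eqxx mulr1 eq_card0 // => j; rewrite !inE.
  case: (eqVneq j x) => [->|_] /=; first by rewrite ltnn.
  by apply/negP => /andP[/(allP xall) /= xj]; rewrite ltnNge ltnW.
have [xT|] := boolP (x \in T); last by rewrite !mul0r.
case: eqP => [TE|]; last by rewrite mulr0.
case/eqP: TN; rewrite -(finset.setD1K xT) TE; apply/finset.setP => i.
by rewrite !inE.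
Qed.

Lemma wedge_delta_in S :
  \big[wedge/ext1]_(i in S) vbase i = [ffun T => (T == S)%:R].
Proof.
rewrite -big_filter wedge_sorted_delta; last first.
  rewrite [index_enum _]unlock -enumT sorted_filter //.
    by move=> ? ? ?; exact: ltn_trans.
  by rewrite -[sorted _ _]/(sorted (relpre val ltn) _) -sorted_map val_enum_ord iota_ltn_sorted.
apply/ffunP => T; rewrite !ffunE; congr (_ == _)%:R.
by apply/finset.setP => i; rewrite !inE mem_filter mem_index_enum andbT.
Qed.

(** Indexing the factors of a monomial by an ordinal of prescribed size gives
    access to the determinant formula [ext_pair_det] for the pairing. *)
Lemma wedge_in_wedge_all j S : #|S| = j -> exists s : 'I_j -> 'I_m,
  forall F : 'I_m -> 'rV[R]_m,
    \big[wedge/ext1]_(i in S) ext_vec (F i) = wedge_all (F \o s).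
Proof.
move=> <-; have size_S : size ([seq i <- index_enum 'I_m | i \in S]) = #|S|.
  by rewrite cardE /enum_mem [index_enum _]unlock.
rewrite -size_S; exists (tnth (in_tuple ([seq i <- index_enum 'I_m | i \in S]))) => F.
by rewrite -big_filter big_tnth.
Qed.

Lemma homogeneous_sum j b : homogeneous j b ->
  b = \sum_(S : {set 'I_m} | #|S| == j) b S *: \big[wedge/ext1]_(i in S) vbase i.
Proof.
move=> hb; apply/ffunP => T; rewrite sum_ffunE.
have [Tj|Tj] := boolP (#|T| == j).
  rewrite (bigD1 T) //= ffunE wedge_delta_in ffunE eqxx big1 ?addr0 => [|S /andP[_ SNT]].
    by rewrite -[_ *: _]/(_ * _) mulr1.
  by rewrite ffunE wedge_delta_in ffunE eq_sym (negPf SNT) scaler0.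
rewrite big1 => [|S Sj]; first by apply/eqP; apply: contraNT Tj => /hb ->.
rewrite ffunE wedge_delta_in ffunE; case: eqP => [TS|]; last by rewrite scaler0.
by rewrite TS Sj in Tj.
Qed.

Lemma homogeneous_ind j (P : ext R m -> Prop) : P 0 ->
  (forall k a b, P a -> P b -> P (k *: a + b)) ->
  (forall s : 'I_j -> 'I_m, P (wedge_all (fun i => delta_mx 0 (s i)))) ->
  forall a, homogeneous j a -> P a.
Proof.
move=> P0 PD Pw a /homogeneous_sum ->.
elim/big_rec : _ => // S b /eqP /wedge_in_wedge_all [s ->] Pb.
by apply: PD => //; exact: Pw.
Qed.

Lemma homogeneous_eq j a b : homogeneous j a -> homogeneous j b ->
  (forall s : 'I_j -> 'I_m,
    ext_pair (wedge_all (fun i => delta_mx 0 (s i))) a =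
    ext_pair (wedge_all (fun i => delta_mx 0 (s i))) b) -> a = b.
Proof.
move=> ha hb ab; apply/ffunP => S.
have pairE c : c S = ext_pair (\big[wedge/ext1]_(i in S) vbase i) c.
  rewrite wedge_delta_in /ext_pair (bigD1 S) //= ffunE eqxx mul1r big1 ?addr0 //.
  by move=> T /negPf TS; rewrite ffunE TS mul0r.
have [Sj|Sj] := eqVneq #|S| j.
  by rewrite !pairE; have [s ->] := wedge_in_wedge_all Sj; exact: ab.
transitivity (0 : R); first by apply/eqP; apply: contraNT Sj => /ha ->.
by apply/esym/eqP; apply: contraNT Sj => /hb ->.
Qed.

Lemma homogeneous_contr j u b : homogeneous j.+1 b -> homogeneous j (contr u b).
Proof.
move=> hb S; apply: contraNeq => Sj; rewrite ffunE big1 // => i iS.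
have [->|/hb] := eqVneq (b (i |: S)) 0; first by rewrite !mulr0.
by rewrite cardsU1 iS => -[] /eqP; rewrite (negPf Sj).
Qed.

Lemma contr1 u : contr u ext1 = 0.
Proof.
apply/ffunP => T; rewrite [LHS]ffunE [RHS]ffunE big1 // => i iT; rewrite ffunE.
by rewrite -cards_eq0 cardsU1 iT !mulr0.
Qed.

(** By linearity [a] is a product of vectors, and [contr_wedge] moves the
    contraction past them one at a time. *)
Lemma contr_antiderivation j u a c : homogeneous j a -> contr u (wedge a c) =
  wedge (contr u a) c + (-1) ^+ j *: wedge a (contr u c).
Proof.
move: a; apply: homogeneous_ind => [|k a b IHa IHb|s].
- by rewrite !(wedge0l, linear0, scaler0, addr0).
- rewrite wedgeDl wedgeZl !linearD !linearZ /= IHa IHb !wedgeDl !wedgeZl !scalerDr.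
  by rewrite !scalerA [k * _]mulrC addrACA.
move: (fun i => delta_mx 0 (s i)) => {s} v; elim: j v => [|j IH] v.
  by rewrite /wedge_all big_ord0 !wedge1l contr1 wedge0l add0r expr0 scale1r.
rewrite /wedge_all big_ord_recl -wedgeA !contr_wedge.
rewrite -/(wedge_all (fun i => v (lift ord0 i))) IH linearD /= linearZ /=.
rewrite wedgeDl wedgeNl wedgeZl wedgeA wedgeA opprD addrA exprS mulN1r scaleNr.
by [].
Qed.

Lemma ext_pair_vec u v : ext_pair (ext_vec u) (ext_vec v) = (u *m v^T) 0 0.
Proof.
have := ext_pair_det (fun i : 'I_1 => u) (fun=> v).
by rewrite /wedge_all !big_ord_recl !big_ord0 !wedger1 det_mx11 mxE.
Qed.

(** The coefficients of [wedge_all v] are minors of [v], so a wedge product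
    inherits the alternating multilinearity of the determinant. *)
Lemma wedge_all_perm j (v : 'I_j -> 'rV[R]_m) (s : 'S_j) :
  wedge_all (v \o s) = (-1) ^+ s *: wedge_all v.
Proof.
apply: (@homogeneous_eq j); first exact: homogeneous_wedge_all.
  by move=> S; rewrite ffunE scaler_eq0 => /norP[_]; exact: homogeneous_wedge_all.
move=> t; rewrite linearZ /= ![ext_pair (wedge_all (fun _ => delta_mx _ _)) _]ext_pairC !ext_pair_det.
rewrite -det_perm -det_mulmx -row_permE; congr (\det _).
by apply/matrixP => i k; rewrite !mxE.
Qed.

Lemma wedge_all_multilinear j (i0 : 'I_j) (k l : R) (v v1 v2 : 'I_j -> 'rV[R]_m) :
  v i0 = k *: v1 i0 + l *: v2 i0 ->
  (forall i, i != i0 -> v1 i = v i) -> (forall i, i != i0 -> v2 i = v i) ->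
  wedge_all v = k *: wedge_all v1 + l *: wedge_all v2.
Proof.
move=> v0 e1 e2; apply: (@homogeneous_eq j); first exact: homogeneous_wedge_all.
  move=> S; apply: contraNeq => Sj; rewrite !ffunE.
  have w0 w : @wedge_all R m j w S = 0.
    by apply/eqP; apply: contraNT Sj => /homogeneous_wedge_all ->.
  by rewrite !w0 !scaler0 addr0.
move=> t; rewrite linearD !linearZ /= ![ext_pair (wedge_all (fun _ => delta_mx _ _)) _]ext_pairC !ext_pair_det.
have lift_neq i : lift i0 i != i0 by rewrite eq_sym neq_lift.
apply: (determinant_multilinear (i0 := i0)).
- apply/rowP => c; rewrite !mxE !mulr_sumr -big_split /=.
  by apply: eq_bigr => q _; rewrite v0 !mxE; ring.
- by apply/matrixP => i c; rewrite !mxE; apply: eq_bigr => q _; rewrite e1.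
- by apply/matrixP => i c; rewrite !mxE; apply: eq_bigr => q _; rewrite e2.
Qed.

Lemma homogeneous_ext_map j (A : 'M[R]_m) b :
  homogeneous j b -> homogeneous j (ext_map A b).
Proof.
move=> hb; rewrite /ext_map (bigID (fun S : {set 'I_m} => #|S| == j)) /= [X in _ + X]big1 ?addr0.
  apply: homogeneous_lincomb => S /eqP /wedge_in_wedge_all [s ->].
  exact: homogeneous_wedge_all.
by move=> S Sj; rewrite [b S](_ : _ = 0) ?scale0r //; apply/eqP; apply: contraNT Sj => /hb ->.
Qed.

(** On a monomial both sides are the same determinant, by [ext_pair_det]. Thus
    pushing multivectors forward is transposed to pulling covectors back, which
    is what compares tensors in two charts. *)
Lemma ext_pair_map j (t : 'I_j -> 'rV[R]_m) (A : 'M[R]_m) b : homogeneous j b ->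
  ext_pair (wedge_all t) (ext_map A b) =
  ext_pair (wedge_all (fun i => t i *m A^T)) b.
Proof.
move=> hb; rewrite [in RHS](homogeneous_sum hb) /ext_map !linear_sum /=.
rewrite (bigID (fun S : {set 'I_m} => #|S| == j)) /= [X in _ + X]big1 ?addr0; last first.
  move=> S Sj; rewrite [b S](_ : _ = 0) ?scale0r ?linear0 //.
  by apply/eqP; apply: contraNT Sj => /hb ->.
apply: eq_bigr => S /eqP /wedge_in_wedge_all [s sE].
rewrite !linearZ /= !sE !ext_pair_det; congr (_ * \det _).
by apply/matrixP => i k; rewrite [LHS]mxE [RHS]mxE /= rowE trmx_mul mulmxA.
Qed.

End MonomialBasis.
Arguments homogeneous_contr {R m j} u {b} _ S _.
Arguments homogeneous_ext_map {R m j} A {b} _ S _.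
Arguments homogeneous_eq {R m} j {a b}.

(** * Bivectors, Pfaffians and the Liouville volume *)

Section Bivectors.
Local Open Scope set_scope.
Context {R : realType} {m : nat}.
Implicit Types (a b c M : ext R m) (A : 'M[R]_m) (u v : 'rV[R]_m).

Local Notation vbase i := (ext_vec (delta_mx 0 i : 'rV[R]_m)).

Lemma vec_dot_delta u i : (u *m (delta_mx 0 i : 'rV[R]_m)^T) 0 0 = u 0 i.
Proof. by rewrite trmx_delta -colE mxE. Qed.

Definition bivector A : ext R m :=
  \sum_(i < m) \sum_(j < m | (i < j)%N) A i j *: wedge (vbase i) (vbase j).

Lemma ext_pair11 : ext_pair (ext1 : ext R m) ext1 = 1.
Proof.
rewrite /ext_pair (bigD1 finset.set0) //= !ffunE eqxx mulr1 big1 ?addr0 //.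
by move=> S /negPf S0; rewrite !ffunE S0 mulr0.
Qed.

Lemma homogeneous_wedge2 u v : homogeneous 2 (wedge (ext_vec u) (ext_vec v)).
Proof. by apply: (@homogeneous_wedge R m 1%N 1%N); exact: homogeneous_vec. Qed.

Lemma homogeneous_bivector A : homogeneous 2 (bivector A).
Proof.
rewrite /bivector; under eq_bigr => i _ do rewrite -[\sum_(_ < _ | _) _]scale1r.
apply: homogeneous_lincomb => i _; apply: homogeneous_lincomb => j _.
exact: homogeneous_wedge2.
Qed.

Lemma wedge_vecC u v : wedge (ext_vec u) (ext_vec v) = - wedge (ext_vec v) (ext_vec u).
Proof.
by rewrite (wedgeC (homogeneous_vec u) (homogeneous_vec v)) expr1 scaleN1r.
Qed.

Lemma ext_pair_bivector A u v : A^T = - A ->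
  ext_pair (wedge (ext_vec u) (ext_vec v)) (bivector A) = (u *m A *m v^T) 0 0.
Proof.
move=> skewA; have AE i j : A j i = - A i j.
  by have /matrixP/(_ i j) := skewA; rewrite !mxE.
have A0 i : A i i = 0 by have := AE i i; lra.
have -> : (u *m A *m v^T) 0 0 = \sum_i \sum_j u 0 i * A i j * v 0 j.
  rewrite mxE exchange_big /=; apply: eq_bigr => j _.
  by rewrite !mxE mulr_suml.
have sumE (F : 'I_m -> 'I_m -> R) : (forall i, F i i = 0) ->
    \sum_i \sum_j F i j = \sum_(i < m) \sum_(j < m | (i < j)%N) (F i j + F j i).
  move=> F0; under [RHS]eq_bigr do rewrite big_split /=.
  rewrite big_split /= [X in _ = _ + X](exchange_big_dep xpredT) //= -big_split /=.
  apply: eq_bigr => i _; rewrite (bigID (fun j : 'I_m => (i < j)%N)) /=; congr (_ + _).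
  rewrite (bigD1 i) /= ?ltnn // F0 add0r; apply: eq_bigl => j.
  by rewrite -leqNgt ltn_neqAle andbC -val_eqE.
rewrite sumE => [|i]; last by rewrite A0 mulr0 mul0r.
rewrite /bivector linear_sum; apply: eq_bigr => i _.
rewrite linear_sum; apply: eq_bigr => j _.
rewrite linearZ /= ext_pair_wedge2 !vec_dot_delta (AE i j).
by ring.
Qed.

Lemma wedge_all2 (v : 'I_2 -> 'rV[R]_m) :
  wedge_all v = wedge (ext_vec (v ord0)) (ext_vec (v ord_max)).
Proof.
rewrite /wedge_all !big_ord_recl big_ord0 wedger1.
by congr (wedge _ (ext_vec (v _))); apply: val_inj.
Qed.

Lemma trmx_invmx_skew A : A^T = - A -> A \in unitmx ->
  ((invmx A)^T)^T = - (invmx A)^T.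
Proof.
move=> skewA uA; rewrite trmxK trmx_inv skewA -[- A]scaleN1r invmxZ.
  by rewrite invrN1 scaleN1r opprK.
by rewrite scaleN1r -skewA unitmx_tr.
Qed.

Lemma form_matrix_skew a : (form_matrix a)^T = - form_matrix a.
Proof. by apply/matrixP => i j; rewrite !mxE wedge_vecC linearN. Qed.

Lemma form_matrixK a : homogeneous 2 a -> bivector (form_matrix a) = a.
Proof.
move=> ha; apply: (homogeneous_eq 2%N); [exact: homogeneous_bivector | by [] | move=> s].
rewrite wedge_all2 (ext_pair_bivector _ _ (form_matrix_skew a)).
by rewrite vec_dot_delta -rowE !mxE ext_pairC.
Qed.

Lemma ext_pair_form a u v : homogeneous 2 a ->
  ext_pair (wedge (ext_vec u) (ext_vec v)) a = (u *m form_matrix a *m v^T) 0 0.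
Proof.
by move=> ha; rewrite -{1}(form_matrixK ha) (ext_pair_bivector _ _ (form_matrix_skew a)).
Qed.

Lemma form_matrix_bivector A : A^T = - A -> form_matrix (bivector A) = A.
Proof.
move=> skewA; apply/matrixP => i j; rewrite mxE ext_pairC ext_pair_bivector //.
by rewrite vec_dot_delta -rowE mxE.
Qed.

Lemma contr_form a u : homogeneous 2 a ->
  contr u a = ext_vec (u *m form_matrix a).
Proof.
move=> ha; have hc := homogeneous_contr u ha.
apply: (homogeneous_eq 1%N); [exact: hc | exact: homogeneous_vec | move=> s].
rewrite /wedge_all !big_ord_recl !big_ord0 !wedger1 -ext_pair_wedge ext_pair_form //.
by rewrite ext_pairC ext_pair_vec.
Qed.

Lemma ext_pair_vec_wedge j (v : 'I_j.+1 -> 'rV[R]_m) u b :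
  ext_pair (wedge_all v) (wedge (ext_vec u) b) =
  \sum_(i < j.+1) (-1) ^+ i * (u *m (v i)^T) 0 0 * ext_pair (wedge_all (v \o lift i)) b.
Proof.
rewrite ext_pairC ext_pair_wedge ext_pairC contr_wedge_all ext_pairC linear_sum.
by apply: eq_bigr => i _; rewrite linearZ /= ext_pairC.
Qed.

Lemma wedge_form_comm j M b : homogeneous 2 M -> homogeneous j b ->
  wedge b M = wedge M b.
Proof. by move=> hM hb; rewrite (wedgeC hb hM) muln2 -signr_odd odd_double scale1r. Qed.

(** Contraction is a derivation on the commutative algebra of even elements. *)
Lemma contr_wedge_pow u M k : homogeneous 2 M ->
  contr u (wedge_pow M k.+1) = k.+1%:R *: wedge (contr u M) (wedge_pow M k).
Proof.
move=> hM; have hc := homogeneous_contr u hM.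
elim: k => [|k IH]; first by rewrite /wedge_pow /= !wedger1 scale1r.
rewrite [wedge_pow M k.+2]/(wedge M (wedge_pow M k.+1)) (contr_antiderivation _ _ hM).
have MC : wedge M (wedge (contr u M) (wedge_pow M k)) =
    wedge (contr u M) (wedge_pow M k.+1).
  by rewrite wedgeA -(wedge_form_comm hM hc) -wedgeA.
rewrite sqrrN expr1n scale1r IH linearZ /= MC -{1}[wedge (contr u M) _]scale1r.
by rewrite -scalerDl nat1r.
Qed.

(** Expansion of a Pfaffian along its first row: move the first vector to the
    other side of the pairing, where it differentiates the power. *)
Lemma ext_pair_wedge_pow_rec M k (v : 'I_k.+1.*2 -> 'rV[R]_m) : homogeneous 2 M ->
  ext_pair (wedge_all v) (wedge_pow M k.+1) =
  k.+1%:R * \sum_(i < k.*2.+1) (-1) ^+ i *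
    ext_pair (wedge (ext_vec (v ord0)) (ext_vec (v (lift ord0 i)))) M *
    ext_pair (wedge_all (fun l => v (lift ord0 (lift i l)))) (wedge_pow M k).
Proof.
move=> hM; rewrite {1}/wedge_all big_ord_recl ext_pair_wedge contr_wedge_pow // linearZ /=.
congr (_ * _); rewrite contr_form // -[X in ext_pair X]/(wedge_all (fun i => v (lift ord0 i))).
by rewrite ext_pair_vec_wedge; apply: eq_bigr => i _; rewrite ext_pair_form.
Qed.

End Bivectors.

Arguments homogeneous_bivector {R m} A S _.

(** The pairing with a power of a bivector is a multiple of the Pfaffian of the
    matrix of values of the bivector, so only these values matter; in
    particular the vectors may be traded for the basis of an auxiliary space. *)
Lemma ext_pair_wedge_pow_eq (R : realType) (m m' k : nat)
    (M : ext R m) (M' : ext R m') (v : 'I_k.*2 -> 'rV[R]_m) (v' : 'I_k.*2 -> 'rV[R]_m') :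
  homogeneous 2 M -> homogeneous 2 M' ->
  (forall i j, ext_pair (wedge (ext_vec (v i)) (ext_vec (v j))) M =
               ext_pair (wedge (ext_vec (v' i)) (ext_vec (v' j))) M') ->
  ext_pair (wedge_all v) (wedge_pow M k) = ext_pair (wedge_all v') (wedge_pow M' k).
Proof.
move=> hM hM'; elim: k v v' => [|k IH] v v' vv'.
  by rewrite /wedge_all !big_ord0 !ext_pair11.
rewrite !ext_pair_wedge_pow_rec //; congr (_ * _); apply: eq_bigr => i _.
by rewrite vv'; congr (_ * _); apply: IH => p q; exact: vv'.
Qed.

Section Liouville.
Context {R : realType} {n : nat}.
Variables (a : ext R n.*2) (a_homog : homogeneous 2 a).
Hypothesis a_nondeg : form_matrix a \in unitmx.

Lemma inv_form_skew : ((invmx (form_matrix a))^T)^T = - (invmx (form_matrix a))^T.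
Proof.
by apply: trmx_invmx_skew => //; exact: form_matrix_skew.
Qed.

Lemma ext_pair_inv u v : ext_pair (wedge (ext_vec u) (ext_vec v)) (ext_inv a) =
  (u *m (invmx (form_matrix a))^T *m v^T) 0 0.
Proof. exact: ext_pair_bivector inv_form_skew. Qed.

Lemma homogeneous_ext_inv : homogeneous 2 (ext_inv a).
Proof. exact: homogeneous_bivector. Qed.

(** Induction on [k]: with Y dual to the first covector v_0, so that
    contr Y a = - v_0, contract by Y the vanishing form of degree 2n+1
    v_1 /\ ... /\ v_(2k-1) /\ a^(n-k+1). This trades v_0 /\ a^(n-k) for
    a^(n-k+1) and expands exactly as a Pfaffian along its first row. *)
Lemma wedge_all_form_pow k (v : 'I_k.*2 -> 'rV[R]_n.*2) : (k <= n)%N ->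
  ext_pair (wedge_all v) (wedge_pow (ext_inv a) k) *:
    ((n`!)%:R^-1 *: wedge_pow a n) =
  k`!%:R *: wedge (wedge_all v) (((n - k)`!)%:R^-1 *: wedge_pow a (n - k)).
Proof.
elim: k v => [|k IH] v kn.
  by rewrite /wedge_all !big_ord0 subn0 scale1r wedge1l ext_pair11 scale1r.
rewrite (ext_pair_wedge_pow_rec _ homogeneous_ext_inv).
(* Contraction maps each divided power to the previous one, without factor. *)
set d := (n - k)`!%:R^-1 *: wedge_pow a (n - k).
set c := (n - k.+1)`!%:R^-1 *: wedge_pow a (n - k.+1).
pose v' (i : 'I_k.*2.+1) := v (lift ord0 i).
pose Y := v ord0 *m (invmx (form_matrix a))^T.
have contrYd : contr Y d = - wedge (ext_vec (v ord0)) c.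
  have nkE : (n - k = (n - k.+1).+1)%N by rewrite subnSK.
  rewrite /d nkE linearZ /= contr_wedge_pow // scalerA factS natrM.
  rewrite invfM mulrAC mulVf ?pnatr_eq0 // mul1r contr_form // /Y -mulmxA.
  rewrite -[(invmx _)^T]opprK -inv_form_skew trmxK mulNmx mulVmx // mulmxN mulmx1.
  by rewrite linearN wedgeNl scalerN /c -linearZ.
have d_hom : homogeneous (n - k).*2 d.
  rewrite /d => S; rewrite ffunE scaler_eq0 => /norP[_].
  exact: homogeneous_wedge_pow.
have c_hom : homogeneous (n - k.+1).*2 c.
  rewrite /c => S; rewrite ffunE scaler_eq0 => /norP[_].
  exact: homogeneous_wedge_pow.
have top0 : wedge (wedge_all v') d = 0.
  apply: homogeneous_gt (homogeneous_wedge (homogeneous_wedge_all v') d_hom).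
  by rewrite addSn ltnS -doubleD subnKC // ltnW.
have := contr_antiderivation Y d (homogeneous_wedge_all v').
rewrite top0 linear0 contrYd -signr_odd /= odd_double expr1 scaleN1r linearN opprK /=.
rewrite wedgeA (wedgeC (homogeneous_wedge_all v') (homogeneous_vec _)) muln1.
rewrite -signr_odd /= odd_double expr1 scaleN1r wedgeNl -wedgeA => /esym/eqP.
rewrite subr_eq0 => /eqP E.
have -> : wedge_all v = wedge (ext_vec (v ord0)) (wedge_all v').
  exact: big_ord_recl.
rewrite -wedgeA -E contr_wedge_all.
rewrite wedge_suml scaler_sumr -scalerA scaler_suml scaler_sumr; apply: eq_bigr => i _.
rewrite ext_pair_inv -/Y -[(_ * ext_pair _ _) *: _]scalerA IH ?(ltnW kn) // wedgeZl !scalerA factS natrM.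
by congr (_ *: _); ring.
Qed.

(** For k = n the previous identity writes the volume of the standard basis as a
    multiple of [wedge_pow a n]. *)
Lemma wedge_pow_neq0 : wedge_pow a n != 0.
Proof.
apply/negP => /eqP an0.
have := wedge_all_form_pow (fun i => delta_mx 0 i) (leqnn n).
rewrite an0 !scaler0 subnn invr1 scale1r wedger1 => /esym/eqP.
rewrite scaler_eq0 pnatr_eq0 eqn0Ngt fact_gt0 /=.
apply/negP/eqP => /(congr1 (ext_pair (wedge_all (fun i => delta_mx 0 i)))).
rewrite linear0 ext_pair_det [X in \det X](_ : _ = 1%:M) ?det1 => [/eqP|].
  by rewrite oner_eq0.
by apply/matrixP => i j; rewrite mxE delta_mx_dot mxE.
Qed.

End Liouville.

(** * Alternating sums of products of minors *)

Section Shuffle.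
Context {R : realType} {m : nat}.
Implicit Types (A B : ext R m).

(** Take A and B to be monomials. The product of the two minors is the
    determinant of a block diagonal matrix, expanded over permutations r. After
    the change of variables s = r * s' the block structure only sees r, and the
    sum over s' is a full determinant; N counts the permutations r that
    preserve the two blocks. *)
Lemma ext_pair_shuffle (p q : nat) : exists N : R,
  forall A B (v : 'I_(p + q) -> 'rV[R]_m), homogeneous p A -> homogeneous q B ->
  \sum_(s : 'S_(p + q)) (-1) ^+ s *
    (ext_pair (wedge_all (fun i => v (s (lshift q i)))) A *
     ext_pair (wedge_all (fun i => v (s (rshift p i)))) B) =
  N * ext_pair (wedge_all v) (wedge A B).
Proof.
(* The indicator of the diagonal blocks. *)
pose same (i j : 'I_(p + q)) : R := ((i < p)%N == (j < p)%N)%:R.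
exists (\sum_(r : 'S_(p + q)) \prod_i same i (r i)) => A B v hA hB.
move: A hA; apply: homogeneous_ind => [|k A A' IH IH'|x].
- rewrite wedge0l linear0 mulr0 big1 // => s _.
  by rewrite linear0 mul0r mulr0.
- rewrite wedgeDl wedgeZl linearD linearZ /= mulrDr [_ * (k * _)]mulrCA -IH -IH'.
  rewrite mulr_sumr -big_split /=; apply: eq_bigr => s _.
  by rewrite linearD linearZ /= mulrDl mulrDr -mulrA [_ * (k * _)]mulrCA.
move: (fun i => delta_mx 0 (x i)) => {}x.
move: B hB; apply: homogeneous_ind => [|k B B' IH IH'|y].
- rewrite !linear0 mulr0 big1 // => s _.
  by rewrite linear0 !mulr0.
- rewrite !linearD !linearZ /= mulrDr [_ * (k * _)]mulrCA -IH -IH'.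
  rewrite mulr_sumr -big_split /=; apply: eq_bigr => s _.
  by rewrite linearD linearZ /= !mulrDr [_ * (k * _)]mulrCA [_ * (k * _)]mulrCA.
move: (fun i => delta_mx 0 (y i)) => {}y.
pose z i := match fintype.split i with inl j => x j | inr j => y j end.
have -> : wedge (wedge_all x) (wedge_all y) = wedge_all z.
  rewrite /wedge_all big_split_ord /=; congr (wedge _ _); apply: eq_bigr => i _.
    by rewrite /z (unsplitK (inl i)).
  by rewrite /z (unsplitK (inr i)).
pose V i j : R := (v i *m (z j)^T) 0 0.
rewrite ext_pair_det.
have detE (s : 'S_(p + q)) :
    ext_pair (wedge_all (fun i => v (s (lshift q i)))) (wedge_all x) *
    ext_pair (wedge_all (fun i => v (s (rshift p i)))) (wedge_all y) =
    \sum_(r : 'S_(p + q)) (-1) ^+ r * \prod_i (V (s i) (r i) * same i (r i)).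
  rewrite !ext_pair_det -(det_lblock _ 0) /determinant.
  apply: eq_bigr => r _; congr (_ * _); apply: eq_bigr => i _.
  move: (r i) => j; rewrite -(fintype.splitK i) -(fintype.splitK j) /V /z /same.
  case: (fintype.split i) => i'; case: (fintype.split j) => j';
    rewrite ?block_mxEul ?block_mxEur ?block_mxEdl ?block_mxEdr !unsplitK mxE /=.
  - by rewrite !ltn_ord eqxx mulr1.
  - by rewrite ltn_ord ltnNge leq_addr mulr0.
  - by rewrite ltn_ord ltnNge leq_addr mulr0.
  - by rewrite !ltnNge !leq_addr mulr1.
under eq_bigr do rewrite detE mulr_sumr.
rewrite exchange_big mulr_suml; apply: eq_bigr => r _ /=.
rewrite -det_tr /determinant mulr_sumr (reindex_inj (mulgI r)) /=; apply: eq_bigr => s _.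
rewrite odd_permM big_split /= [X in _ * (_ * (X * _))](_ : _ = \prod_j V (s j) j); last first.
  rewrite [RHS](reindex_inj (@perm_inj _ r)) /=.
  by apply: eq_bigr => i _; rewrite permM.
rewrite signr_addb [X in _ = _ * (_ * X)](_ : _ = \prod_j V (s j) j); last first.
  by apply: eq_bigr => i _; rewrite mxE [LHS]mxE.
have := sqrr_sign R r; rewrite expr2.
move: ((-1) ^+ r) => e ee; set x1 := \prod_i _; set x2 := \prod_i _.
move: ((-1) ^+ s) x1 x2 => f x1 x2.
transitivity (e * e * (x1 * (f * x2))); first by ring.
by rewrite ee mul1r; ring.
Qed.

End Shuffle.

Section ThreeForms.
Local Open Scope set_scope.
Context {R : realType} {m : nat}.
Local Notation vbase i := (ext_vec (delta_mx 0 i : 'rV[R]_m)).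

Lemma wedge_all3 (v : 'I_3 -> 'rV[R]_m) : wedge_all v =
  wedge (ext_vec (v ord0)) (wedge (ext_vec (v (inord 1))) (ext_vec (v (inord 2)))).
Proof.
rewrite /wedge_all !big_ord_recl big_ord0 wedger1.
by congr wedge; congr wedge; congr (ext_vec (v _)); apply: val_inj; rewrite /= inordK.
Qed.

Lemma ext_pair_sum_wedge (b : 'I_m -> ext R m) i j l :
  ext_pair (wedge (vbase i) (wedge (vbase j) (vbase l))) (\sum_a wedge (vbase a) (b a)) =
  ext_pair (wedge (vbase j) (vbase l)) (b i)
  - ext_pair (wedge (vbase i) (vbase l)) (b j)
  + ext_pair (wedge (vbase i) (vbase j)) (b l).
Proof.
pose v (k : 'I_3) : 'rV[R]_m := delta_mx 0 (tnth [tuple i; j; l] k).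
have -> : wedge (vbase i) (wedge (vbase j) (vbase l)) = wedge_all v.
  by rewrite wedge_all3 /v !(tnth_nth i) /= !inordK.
have sumE q (F : 'I_m -> R) : \sum_a ((delta_mx 0 a : 'rV[R]_m) *m (delta_mx 0 q : 'rV[R]_m)^T) 0 0 * F a = F q.
  rewrite (bigD1 q) //= delta_mx_dot eqxx mul1r big1 ?addr0 // => a /negPf aq.
  by rewrite delta_mx_dot aq mul0r.
rewrite linear_sum /=; under eq_bigr do rewrite ext_pair_vec_wedge.
rewrite exchange_big /= !big_ord_recl big_ord0 addr0 addrA.
have rowE (k : 'I_3) (X : ext R m) : wedge_all (v \o lift k) = X ->
    \sum_a (-1) ^+ k * ((delta_mx 0 a : 'rV[R]_m) *m (v k)^T) 0 0 * ext_pair (wedge_all (v \o lift k)) (b a) =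
    (-1) ^+ k * ext_pair X (b (tnth [tuple i; j; l] k)).
  by move=> ->; rewrite -[in RHS](sumE _ (fun a => ext_pair X (b a))) mulr_sumr; apply: eq_bigr => a _; rewrite mulrA.
rewrite !(rowE _ _ (wedge_all2 _)) /v /= !(tnth_nth i) /=.
by rewrite /bump /= expr0 expr1 sqrrN expr1n mul1r mulN1r mul1r.
Qed.

(** The left side alternates a trilinear form that is skew in its last two
    arguments, and such an alternation is a cyclic sum. Read from left to right
    this unfolds d w = 0; read from right to left it turns the Jacobi identity
    into the vanishing of a trivector. *)
Lemma sum_wedge_eq0 (b : 'I_m -> ext R m) : (forall a, homogeneous 2 (b a)) ->
  \sum_a wedge (vbase a) (b a) = 0 <->
  forall i j l, ext_pair (wedge (vbase j) (vbase l)) (b i)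
    + ext_pair (wedge (vbase l) (vbase i)) (b j)
    + ext_pair (wedge (vbase i) (vbase j)) (b l) = 0.
Proof.
move=> hb; have pairE i j l : ext_pair (wedge (vbase i) (wedge (vbase j) (vbase l)))
      (\sum_a wedge (vbase a) (b a)) =
    ext_pair (wedge (vbase j) (vbase l)) (b i)
    + ext_pair (wedge (vbase l) (vbase i)) (b j)
    + ext_pair (wedge (vbase i) (vbase j)) (b l).
  by rewrite ext_pair_sum_wedge [wedge (vbase l) _]wedge_vecC ext_pairC
    [ext_pair (- _) _]ext_pairC linearN /= ![ext_pair (b _) _]ext_pairC.
split=> [S0 i j l|S0]; first by rewrite -pairE S0 linear0.
apply: (homogeneous_eq 3%N).
- under eq_bigr do rewrite -[wedge _ _]scale1r.
  apply: homogeneous_lincomb => a _.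
  exact: (homogeneous_wedge (homogeneous_vec _) (hb a)).
- by move=> S; rewrite ffunE eqxx.
- by move=> s; rewrite wedge_all3 pairE S0 linear0.
Qed.
End ThreeForms.

(** * Symmetry of second derivatives *)

Section SymmetricSecondDerivative.
Context {R : realType} {V : normedModType R}.
Implicit Types (f : V -> R) (x y u v : V).

Lemma is_derive_line f y u (t : R) : derivable f (t *: u + y) u ->
  is_derive t (1 : R) (fun s : R => f (s *: u + y)) ('D_u f (t *: u + y)).
Proof.
move=> df.
have quotE : (fun h : R => h^-1 *: (((fun s : R => f (s *: u + y)) \o shift t) (h *: 1) - f (t *: u + y)))
    = (fun h => h^-1 *: ((f \o shift (t *: u + y)) (h *: u) - f (t *: u + y))).
  by apply/funext => h; rewrite /= [h *: 1]mulr1 scalerDl addrA.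
split; first by rewrite /derivable quotE.
by rewrite /derive quotE.
Qed.

(** The mean value theorem, applied once in each direction. *)
Lemma second_difference f x u v (h : R) : 0 < h ->
  (forall s t, 0 <= s <= h -> 0 <= t <= h ->
    derivable f (s *: u + (t *: v + x)) u /\
    derivable ('D_u f) (t *: v + (s *: u + x)) v) ->
  exists s t, [/\ 0 <= s <= h, 0 <= t <= h &
    f (h *: u + (h *: v + x)) - f (h *: v + x) - (f (h *: u + x) - f x) =
    'D_v ('D_u f) (t *: v + (s *: u + x)) * h * h].
Proof.
move=> h0 df; have h00 : 0 <= h by exact: ltW.
pose phi (s : R) := f (s *: u + (h *: v + x)) - f (s *: u + x).
have dphi s : 0 <= s <= h -> is_derive s (1 : R) phi
    ('D_u f (s *: u + (h *: v + x)) - 'D_u f (s *: u + x)).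
  move=> sh; apply: is_deriveB; apply: is_derive_line.
    by apply: (df s h sh _).1; rewrite h00 lexx.
  have s0 : 0 <= (0 : R) <= h by rewrite lexx.
  by have := (df s 0 sh s0).1; rewrite scale0r add0r.
have [s sI phiE] : exists2 s, s \in `]0, h[%R & phi h - phi 0 =
    ('D_u f (s *: u + (h *: v + x)) - 'D_u f (s *: u + x)) * (h - 0).
  apply: (@MVT R phi (fun s => 'D_u f (s *: u + (h *: v + x)) - 'D_u f (s *: u + x)) 0 h h0) => [s|].
    by rewrite in_itv /= => /andP[s0 sh]; apply: dphi; rewrite !ltW.
  apply: derivable_within_continuous => s; rewrite in_itv /= => sh.
  exact: (@ex_derive _ _ _ _ _ _ _ (dphi s sh)).
have {}sI : 0 <= s <= h by move: sI; rewrite in_itv /= => /andP[? ?]; rewrite !ltW.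
have dpsi t : 0 <= t <= h -> is_derive t (1 : R) (fun t => 'D_u f (t *: v + (s *: u + x)))
    ('D_v ('D_u f) (t *: v + (s *: u + x))).
  by move=> th; apply: is_derive_line; exact: (df s t sI th).2.
have [t tI psiE] : exists2 t, t \in `]0, h[%R &
    'D_u f (h *: v + (s *: u + x)) - 'D_u f (0 *: v + (s *: u + x)) =
    'D_v ('D_u f) (t *: v + (s *: u + x)) * (h - 0).
  apply: (@MVT R (fun t => 'D_u f (t *: v + (s *: u + x)))
    (fun t => 'D_v ('D_u f) (t *: v + (s *: u + x))) 0 h h0) => [t|].
    by rewrite in_itv /= => /andP[t0 th]; apply: dpsi; rewrite !ltW.
  apply: derivable_within_continuous => t; rewrite in_itv /= => th.
  exact: (@ex_derive _ _ _ _ _ _ _ (dpsi t th)).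
exists s, t; split => //.
  by move: tI; rewrite in_itv /= => /andP[? ?]; rewrite !ltW.
move: phiE psiE; rewrite /phi !scale0r !add0r !subr0 [h *: v + (s *: u + x)]addrCA => + psiE.
rewrite psiE => <-.
by rewrite !opprB addrACA [RHS]addrACA; congr (_ + _); exact: addrC.
Qed.

(** The second difference is symmetric in u and v, so both iterated derivatives
    take a common value, at points that are as close to x as one likes. *)
Lemma derive_comm (D : set V) f x u v : open D -> smooth_on D f -> D x ->
  'D_v ('D_u f) x = 'D_u ('D_v f) x.
Proof.
move=> oD sf Dx.
have df w y : D y -> derivable f y w.
  by move=> Dy; apply: diff_derivable; exact: (sf 1%N).1.
have ddf w w' y : D y -> derivable ('D_w f) y w'.
  by move=> Dy; apply: diff_derivable; exact: ((sf 2%N).2 w).1.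
have cont w w' : {for x, continuous ('D_w' ('D_w f))}.
  by apply: differentiable_continuous; exact: (((sf 3%N).2 w).2 w').1.
apply/eqP; apply/negPn/negP => neq.
(* Half of the supposed gap between the two values at x. *)
pose e := `|'D_v ('D_u f) x - 'D_u ('D_v f) x| / 2.
have e0 : 0 < e by rewrite divr_gt0 // normr_gt0 subr_eq0.
have : \forall y \near x, [/\ D y, `|'D_v ('D_u f) x - 'D_v ('D_u f) y| < e
    & `|'D_u ('D_v f) x - 'D_u ('D_v f) y| < e].
  have n1 : \forall y \near x, D y by apply: open_nbhs_nbhs.
  have n2 : \forall y \near x, `|'D_v ('D_u f) x - 'D_v ('D_u f) y| < e.
    by have /cvgrPdist_lt/(_ e e0) := cont u v.
  have n3 : \forall y \near x, `|'D_u ('D_v f) x - 'D_u ('D_v f) y| < e.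
    by have /cvgrPdist_lt/(_ e e0) := cont v u.
  by apply: filterS3 n1 n2 n3 => y a1 a2 a3; split.
move=> /nbhs_ballP[d /= d0 dP].
(* So small that the parallelogram with sides h u and h v stays in the ball. *)
pose h := d / (2 * (`|u| + `|v| + 1)).
have uv0 : 0 < `|u| + `|v| + 1 by rewrite ltr_wpDl ?addr_ge0.
have h0 : 0 < h by rewrite divr_gt0 // mulr_gt0.
have inball s t : 0 <= s <= h -> 0 <= t <= h -> ball x d (s *: u + (t *: v + x)).
  move=> /andP[s0 sh] /andP[t0 th]; rewrite -ball_normE /ball_ /=.
  rewrite addrA opprD [x + _]addrC addrNK normrN (le_lt_trans (ler_normD _ _)) //.
  rewrite !normrZ !ger0_norm // (@le_lt_trans _ _ (h * (`|u| + `|v| + 1))) //.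
    by rewrite !mulrDr mulr1 -[leLHS]addr0 lerD ?(ltW h0) // lerD // ler_wpM2r.
  rewrite /h invfM mulrA mulfVK ?gt_eqF //.
  by rewrite ltr_pdivrMr // mulr2n mulrDr mulr1 ltrDl.
have inball' s t : 0 <= s <= h -> 0 <= t <= h -> ball x d (t *: v + (s *: u + x)).
  by move=> ? ?; rewrite addrCA; exact: inball.
have [|s [t [sI tI E1]]] := @second_difference f x u v h h0.
  move=> s t sI tI; split; first by apply: df; have [] := dP _ (inball s t sI tI).
  by apply: ddf; have [] := dP _ (inball' s t sI tI).
have [|s' [t' [sI' tI' E2]]] := @second_difference f x v u h h0.
  move=> s' t' sI' tI'; split; first by apply: df; have [] := dP _ (inball' t' s' tI' sI').
  by apply: ddf; have [] := dP _ (inball t' s' tI' sI').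
have h_neq0 : h != 0 by rewrite gt_eqF.
have [_ l1 _] := dP _ (inball' s t sI tI).
have [_ _ l2] := dP _ (inball t' s' tI' sI').
move: E1 E2 l1 l2; rewrite [h *: v + (h *: u + x)]addrCA /e.
move: (f (h *: u + (h *: v + x))) (f (h *: v + x)) (f (h *: u + x)) (f x) => f1 f2 f3 f4.
move: ('D_v ('D_u f) _) ('D_u ('D_v f) _) ('D_v _ x) ('D_u _ x) => a b p q E1 E2.
have -> : b = a.
  apply: (mulIf h_neq0); apply: (mulIf h_neq0); rewrite -E1 -E2; ring.
move=> l1 l2; suff : `|p - q| < `|p - q| by rewrite ltxx.
rewrite {2}[`|p - q|]splitr.
by rewrite (le_lt_trans (ler_distD a p q)) // ltrD // distrC.
Qed.

End SymmetricSecondDerivative.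

(** * Smoothness and derivatives of exterior algebra valued functions *)

Section SmoothFunctions.
Context {R : realType} {V : normedModType R}.
Variables (D : set V) (oD : open D).
Implicit Types (f g : V -> R).

Lemma smooth_on_eq (f g : V -> R) : (forall x, D x -> f x = g x) ->
  smooth_on D f -> smooth_on D g.
Proof. by move=> fg sf n; exact: eq_ndifferentiable_on (sf n). Qed.

Lemma eq_smooth_on (f g : V -> R) : f =1 g -> smooth_on D f -> smooth_on D g.
Proof. by move=> /funext ->. Qed.

Lemma smooth_on_cst (c : R) : smooth_on D (fun=> c).
Proof. by move=> n; exact: ndifferentiable_on_cst. Qed.

Lemma smooth_onD f g : smooth_on D f -> smooth_on D g ->
  smooth_on D (fun x => f x + g x).
Proof. by move=> sf sg n; exact: ndifferentiable_onD. Qed.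

Lemma smooth_onM f g : smooth_on D f -> smooth_on D g ->
  smooth_on D (fun x => f x * g x).
Proof. by move=> sf sg n; exact: ndifferentiable_onM. Qed.

Lemma smooth_on_sum (I : Type) (r : seq I) (P : pred I) (F : I -> V -> R) :
  (forall i, P i -> smooth_on D (F i)) ->
  smooth_on D (fun x => \sum_(i <- r | P i) F i x).
Proof.
move=> sF; elim: r => [|i r IH].
  apply: (eq_smooth_on (f := fun=> 0)) (smooth_on_cst _) => x.
  by rewrite big_nil.
have [Pi|nPi] := boolP (P i).
  apply: (eq_smooth_on (f := fun x => F i x + \sum_(j <- r | P j) F j x)).
    by move=> x; rewrite big_cons Pi.
  by apply: smooth_onD => //; exact: sF.
by apply: eq_smooth_on IH => x; rewrite big_cons (negPf nPi).
Qed.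

Lemma smooth_on_prod (I : Type) (r : seq I) (P : pred I) (F : I -> V -> R) :
  (forall i, P i -> smooth_on D (F i)) ->
  smooth_on D (fun x => \prod_(i <- r | P i) F i x).
Proof.
move=> sF; elim: r => [|i r IH].
  apply: (eq_smooth_on (f := fun=> 1)) (smooth_on_cst _) => x.
  by rewrite big_nil.
have [Pi|nPi] := boolP (P i).
  apply: (eq_smooth_on (f := fun x => F i x * \prod_(j <- r | P j) F j x)).
    by move=> x; rewrite big_cons Pi.
  by apply: smooth_onM => //; exact: sF.
by apply: eq_smooth_on IH => x; rewrite big_cons (negPf nPi).
Qed.

Lemma smooth_on_derive f v : smooth_on D f -> smooth_on D ('D_v f).
Proof. by move=> sf n; exact: (sf n.+1).2. Qed.

Lemma smooth_on_differentiable f x : smooth_on D f -> D x -> differentiable f x.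
Proof. by move=> sf; exact: (sf 1%N).1. Qed.

Lemma smooth_on_derivable f v x : smooth_on D f -> D x -> derivable f x v.
Proof. by move=> sf Dx; exact: diff_derivable (smooth_on_differentiable sf Dx). Qed.

(** The derivative of 1 / f is a product of smooth functions and of 1 / f itself,
    whence the induction on the order of differentiation. *)
Lemma smooth_onV f : (forall x, D x -> f x != 0) -> smooth_on D f ->
  smooth_on D (fun x => (f x)^-1).
Proof.
move=> f0 sf; elim=> // n IH; split=> [x Dx|v].
  by apply: differentiableV; [exact: smooth_on_differentiable sf Dx | exact: f0].
apply: (eq_ndifferentiable_on (f := (cst (-1)) * (((fun x => (f x)^-1) * (fun x => (f x)^-1)) * 'D_v f))) => //.
  move=> x Dx; rewrite deriveV ?f0 //; last exact: smooth_on_derivable sf Dx.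
  rewrite -[LHS]/(-1 * ((f x)^-1 * (f x)^-1 * 'D_v f x)) mulN1r -mulNr.
  by rewrite -[RHS]/(_ * _) expr2 invfM.
apply: ndifferentiable_onM => //; first exact: ndifferentiable_on_cst.
apply: ndifferentiable_onM => //; last exact: smooth_on_derive sf n.
exact: ndifferentiable_onM.
Qed.

Lemma smooth_on_det n (A : V -> 'M[R]_n) :
  (forall i j, smooth_on D (fun x => A x i j)) -> smooth_on D (fun x => \det (A x)).
Proof.
move=> sA; apply: smooth_on_sum => s _; apply: smooth_onM; first exact: smooth_on_cst.
by apply: smooth_on_prod => i _; exact: sA.
Qed.

(** Cramer's rule. *)
Lemma smooth_on_invmx n (A : V -> 'M[R]_n) : (forall x, D x -> A x \in unitmx) ->
  (forall i j, smooth_on D (fun x => A x i j)) ->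
  forall i j, smooth_on D (fun x => invmx (A x) i j).
Proof.
move=> uA sA i j; apply: (smooth_on_eq (f := fun x => (\det (A x))^-1 * cofactor (A x) j i)).
  by move=> x Dx; rewrite /invmx uA // !mxE.
apply: smooth_onM.
  apply: smooth_onV => [x Dx|]; last exact: smooth_on_det.
  by have := uA x Dx; rewrite unitmxE unitfE.
apply: smooth_onM; first exact: smooth_on_cst.
apply: smooth_on_det => p q; apply: eq_smooth_on (sA (lift j p) (lift i q)) => x.
by rewrite !mxE.
Qed.

Definition smooth_ext_on (m : nat) (a : V -> ext R m) :=
  forall S, smooth_on D (fun x => a x S).

Lemma smooth_ext_lincomb m (I : Type) (r : seq I) (P : pred I) (k : I -> V -> R)
    (F : I -> ext R m) : (forall i, P i -> smooth_on D (k i)) ->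
  smooth_ext_on (fun x => \sum_(i <- r | P i) k i x *: F i).
Proof.
move=> sk S; apply: (eq_smooth_on (f := fun x => \sum_(i <- r | P i) k i x * F i S)).
  by move=> x; rewrite sum_ffunE; apply: eq_bigr => i _; rewrite ffunE.
apply: smooth_on_sum => i Pi; apply: smooth_onM; first exact: sk.
exact: smooth_on_cst.
Qed.

Lemma smooth_ext_sum m (I : Type) (r : seq I) (P : pred I) (F : I -> V -> ext R m) :
  (forall i, P i -> smooth_ext_on (F i)) ->
  smooth_ext_on (fun x => \sum_(i <- r | P i) F i x).
Proof.
move=> sF S; apply: (eq_smooth_on (f := fun x => \sum_(i <- r | P i) F i x S)).
  by move=> x; rewrite sum_ffunE.
by apply: smooth_on_sum => i Pi; exact: sF.
Qed.

Lemma smooth_ext_wedge m (a b : V -> ext R m) :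
  smooth_ext_on a -> smooth_ext_on b -> smooth_ext_on (fun x => wedge (a x) (b x)).
Proof.
move=> sa sb S; apply: (eq_smooth_on (f := fun x => \sum_(T in powerset S)
    (-1) ^+ inversions T (S :\: T)%SET * a x T * b x (S :\: T)%SET)).
  by move=> x; rewrite ffunE.
apply: smooth_on_sum => T _.
by apply: smooth_onM => //; apply: smooth_onM => //; exact: smooth_on_cst.
Qed.

Lemma smooth_ext_vec m (u : V -> 'rV[R]_m) :
  (forall i, smooth_on D (fun x => u x 0 i)) -> smooth_ext_on (fun x => ext_vec (u x)).
Proof.
move=> su S; apply: (eq_smooth_on (f := fun x => \sum_i u x 0 i * (S == [set i]%SET)%:R)).
  by move=> x; rewrite ffunE; apply: eq_bigr => i _; rewrite mulr_natr.
apply: smooth_on_sum => i _.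
by apply: smooth_onM => //; exact: smooth_on_cst.
Qed.

Lemma smooth_ext_cst m (a : ext R m) : smooth_ext_on (fun=> a).
Proof. by move=> S; exact: smooth_on_cst. Qed.

Lemma smooth_ext_wedge_all m j (u : 'I_j -> V -> 'rV[R]_m) :
  (forall l i, smooth_on D (fun x => u l x 0 i)) ->
  smooth_ext_on (fun x => wedge_all (fun l => u l x)).
Proof.
elim: j u => [|j IH] u su S.
  apply: (eq_smooth_on (f := fun=> ext1 S)) (smooth_on_cst _) => x.
  by rewrite /wedge_all big_ord0.
apply: (eq_smooth_on (f := fun x => wedge (ext_vec (u ord0 x))
    (wedge_all (fun l => u (lift ord0 l) x)) S)).
  by move=> x; rewrite /wedge_all big_ord_recl.
apply: smooth_ext_wedge; first by apply: smooth_ext_vec => i; exact: su.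
by apply: (IH (fun l => u (lift ord0 l))) => l i; exact: su.
Qed.

Lemma smooth_ext_wedge_pow m (a : V -> ext R m) k :
  smooth_ext_on a -> smooth_ext_on (fun x => wedge_pow (a x) k).
Proof.
move=> sa; elim: k => [|k IH]; first exact: smooth_ext_cst.
exact: smooth_ext_wedge.
Qed.

Lemma smooth_ext_pair m (a b : V -> ext R m) :
  smooth_ext_on a -> smooth_ext_on b -> smooth_on D (fun x => ext_pair (a x) (b x)).
Proof. by move=> sa sb; apply: smooth_on_sum => S _; exact: smooth_onM. Qed.

Lemma smooth_ext_inv m (a : V -> ext R m) :
  (forall x, D x -> form_matrix (a x) \in unitmx) -> smooth_ext_on a ->
  smooth_ext_on (fun x => ext_inv (a x)).
Proof.
move=> ua sa; apply: smooth_ext_sum => i _; apply: smooth_ext_lincomb => j _.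
apply: (eq_smooth_on (f := fun x => invmx (form_matrix (a x)) j i)) => [x|]; first by rewrite mxE.
apply: smooth_on_invmx => // p q.
apply: (eq_smooth_on (f := fun x => ext_pair (a x)
  (wedge (ext_vec (delta_mx 0 p)) (ext_vec (delta_mx 0 q))))) => [x|]; first by rewrite mxE.
exact: smooth_ext_pair (smooth_ext_cst _).
Qed.

End SmoothFunctions.

Section DerivativeOfPowers.
Context {R : realType} {V : normedModType R} {m : nat}.

Definition is_derive_ext (x v : V) (a : V -> ext R m) (da : ext R m) :=
  forall S, is_derive x v (fun y => a y S) (da S).

Lemma is_derive_val (f : V -> R) df x v : is_derive x v f df -> 'D_v f x = df.
Proof. by move=> Df; rewrite derive_val. Qed.

Lemma eq_is_derive (f g : V -> R) df x v : f =1 g ->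
  is_derive x v f df -> is_derive x v g df.
Proof. by move=> /funext ->. Qed.

Lemma is_derive_bigsum (I : Type) (r : seq I) (P : pred I) (F : I -> V -> R)
    (dF : I -> R) x v :
  (forall i, P i -> is_derive x v (F i) (dF i)) ->
  is_derive x v (fun y => \sum_(i <- r | P i) F i y) (\sum_(i <- r | P i) dF i).
Proof.
move=> dFi; elim: r => [|i r IH].
  rewrite big_nil; apply: (eq_is_derive _ (is_derive_cst (0 : R) x v)) => y.
  by rewrite big_nil.
rewrite big_cons; have [Pi|nPi] := boolP (P i); last first.
  by apply: eq_is_derive IH => y; rewrite big_cons (negPf nPi).
apply: (eq_is_derive _ (is_deriveD (dFi i Pi) IH)) => y.
by rewrite big_cons Pi.
Qed.

Lemma is_derive_mul x v (f g : V -> R) df dg :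
  is_derive x v f df -> is_derive x v g dg ->
  is_derive x v (fun y => f y * g y) (df * g x + f x * dg).
Proof.
move=> Df Dg; apply: (is_derive_eq (is_deriveM Df Dg)).
by rewrite addrC [g x *: df]mulrC.
Qed.

Lemma is_derive_wedge x v (a b : V -> ext R m) da db :
  is_derive_ext x v a da -> is_derive_ext x v b db ->
  is_derive_ext x v (fun y => wedge (a y) (b y)) (wedge da (b x) + wedge (a x) db).
Proof.
move=> Da Db S.
apply: (eq_is_derive (f := fun y => \sum_(T in powerset S)
    ((-1) ^+ inversions T (S :\: T)%SET * a y T) * b y (S :\: T)%SET)) => [y|].
  by rewrite ffunE.
rewrite !ffunE -big_split /=; apply: is_derive_bigsum => T _.
apply: (is_derive_eq (is_derive_mul (is_derive_mul (is_derive_cst _ _ _) (Da T)) (Db _))).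
by rewrite mul0r add0r.
Qed.

Lemma is_derive_wedge_pow x v (a : V -> ext R m) da k :
  (forall y, homogeneous 2 (a y)) -> homogeneous 2 da -> is_derive_ext x v a da ->
  is_derive_ext x v (fun y => wedge_pow (a y) k.+1)
    (k.+1%:R *: wedge da (wedge_pow (a x) k)).
Proof.
move=> ha hda Da; elim: k => [|k IH].
  rewrite scale1r wedger1 => S; apply: eq_is_derive (Da S) => y.
  by rewrite /wedge_pow /= wedger1.
have := is_derive_wedge Da IH; congr is_derive_ext.
have MC : wedge (a x) (wedge da (wedge_pow (a x) k)) = wedge da (wedge_pow (a x) k.+1).
  by rewrite wedgeA -(wedge_form_comm (ha x) hda) -wedgeA.
by rewrite linearZ /= MC -{1}[wedge da _]scale1r -scalerDl nat1r.
Qed.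

Lemma is_derive_ext_pair x v (a : V -> ext R m) da (b : ext R m) :
  is_derive_ext x v a da ->
  is_derive x v (fun y => ext_pair b (a y)) (ext_pair b da).
Proof.
move=> Da; apply: is_derive_bigsum => S _.
apply: (is_derive_eq (is_derive_mul (is_derive_cst _ _ _) (Da S))).
by rewrite mul0r add0r.
Qed.

Lemma is_derive_bivector x v (A : V -> 'M[R]_m) (dA : 'M[R]_m) :
  (forall i j, is_derive x v (fun y => A y i j) (dA i j)) ->
  is_derive_ext x v (fun y => bivector (A y)) (bivector dA).
Proof.
move=> DA S; apply: (@eq_is_derive (fun y => \sum_(i < m) \sum_(j < m | (i < j)%N)
    A y i j * wedge (ext_vec (delta_mx 0 i)) (ext_vec (delta_mx 0 j)) S)) => [y|].
  rewrite sum_ffunE; apply: eq_bigr => i _.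
  by rewrite sum_ffunE; apply: eq_bigr => j _; rewrite [RHS]ffunE.
rewrite [bivector dA S](_ : _ = \sum_(i < m) \sum_(j < m | (i < j)%N)
    dA i j * wedge (ext_vec (delta_mx 0 i)) (ext_vec (delta_mx 0 j)) S); last first.
  rewrite sum_ffunE; apply: eq_bigr => i _.
  by rewrite sum_ffunE; apply: eq_bigr => j _; rewrite [LHS]ffunE.
apply: is_derive_bigsum => i _; apply: is_derive_bigsum => j _.
apply: (is_derive_eq (is_derive_mul (DA i j) (is_derive_cst _ _ _))).
by rewrite mulr0 addr0.
Qed.

End DerivativeOfPowers.

(** * Functions on a manifold and the bracket of a multivector field *)

Section FlatGradient.
Context {R : realType} {m : nat}.
Implicit Types (F : 'rV[R]_m -> R).

Definition grad F (x : 'rV[R]_m) : 'rV[R]_m := \row_i 'D_(delta_mx 0 i) F x.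

Lemma derive_grad F x v : differentiable F x ->
  'D_v F x = (v *m (grad F x)^T) 0 0.
Proof.
move=> dF; rewrite deriveE // [in LHS](row_sum_delta v) linear_sum mxE.
by apply: eq_bigr => i _; rewrite linearZ !mxE deriveE.
Qed.

Lemma near_eq_grad F G x : (\near x, F x = G x) -> grad F x = grad G x.
Proof. by move=> FG; apply/rowP => i; rewrite !mxE; apply: near_eq_derive. Qed.

Lemma grad_comp F (phi : 'rV[R]_m -> 'rV[R]_m) x :
  differentiable phi x -> differentiable F (phi x) ->
  grad (F \o phi) x = grad F (phi x) *m ('J phi x)^T.
Proof.
move=> dphi dF; apply/rowP => i; rewrite [LHS]mxE deriveE; last exact: differentiable_comp.
rewrite diff_comp //= -deriveE // derive_grad // -deriveE // deriveEjacobian //.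
transitivity ((grad F (phi x) *m ('J phi x)^T *m (delta_mx 0 i : 'rV[R]_m)^T)^T 0 0).
  by rewrite !trmx_mul !trmxK mulmxA.
by rewrite mxE vec_dot_delta.
Qed.
End FlatGradient.

Section Charts.
Context {R : realType} {m : nat} {M : manifold R m}.
Implicit Types (c : chart R m M) (p : M) (f g : Cinf M).

Lemma chart_img_map c p : chart_dom c p -> chart_img c (c p).
Proof. by move=> cp; exists p. Qed.

(** Continuity of the inverse charts makes the overlap of two charts open in
    coordinates, so that germs can be compared. *)
Lemma near_chart_inv c c' p : chart_dom c p -> chart_dom c' p ->
  \forall y \near c p, chart_dom c (chart_inv c y) /\ chart_dom c' (chart_inv c y) /\
    y = c (chart_inv c y).
Proof.
move=> cp c'p; have img_p := chart_img_map cp.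
have img_near : \forall y \near c p, chart_img c y.
  by apply: open_nbhs_nbhs; split => //; exact: open_chart_img.
have cont_inv : {for c p, continuous (chart_inv c)}.
  have := chart_inv_continuous (c := c).
  rewrite continuous_open_subspace; last exact: open_chart_img.
  by apply; rewrite inE.
have c'_near : \forall y \near c p, chart_dom c' (chart_inv c y).
  apply: cont_inv; rewrite chart_mapK //.
  by apply: open_nbhs_nbhs; split => //; exact: open_chart_dom.
apply: filterS2 img_near c'_near => y [q cq <-]; rewrite chart_mapK //.
Qed.

Lemma smooth_near_chart f c : atlas M c -> smooth_on (chart_img c) (f \o chart_inv c).
Proof. by move=> ac; case: f => f sf; exact: (smooth_funP _ sf). Qed.

Lemma transition_differentiable c c' p : atlas M c -> atlas M c' ->
  chart_dom c p -> chart_dom c' p -> differentiable (c' \o chart_inv c) (c p).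
Proof.
move=> ac ac' cp c'p; apply: (atlas_smooth ac ac' 1%N).1.
by exists p.
Qed.

(** Near c p the local expression of f in c is the one in c' composed with the
    change of coordinates; apply the chain rule. *)
Lemma gradient_transition f c c' p : atlas M c -> atlas M c' ->
  chart_dom c p -> chart_dom c' p ->
  gradient f c (c p) = gradient f c' (c' p) *m (transition_jacobian c c' p)^T.
Proof.
move=> ac ac' cp c'p; rewrite /transition_jacobian.
have c'E : (c' \o chart_inv c) (c p) = c' p by rewrite /= chart_mapK.
rewrite -c'E -[gradient f c' _]/(grad (f \o chart_inv c') _) -grad_comp.
- apply: near_eq_grad; apply: filterS (near_chart_inv cp c'p) => y [_ [c'y _]] /=.
  by rewrite chart_mapK.
- exact: transition_differentiable.
- rewrite c'E; apply: smooth_on_differentiable (chart_img_map c'p).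
  exact: smooth_near_chart.
Qed.

Definition chart_at p : chart R m M := s2val (cid2 (atlas_cover p)).

Lemma atlas_chart_at p : atlas M (chart_at p).
Proof. by rewrite /chart_at; case: cid2. Qed.

Lemma chart_at_dom p : chart_dom (chart_at p) p.
Proof. by rewrite /chart_at; case: cid2. Qed.

(** The function on M with the local expressions F; the choice of chart is
    immaterial as soon as they are compatible. *)
Definition glue (F : chart R m M -> 'rV[R]_m -> R) p : R := F (chart_at p) (chart_at p p).

Definition chart_compatible (F : chart R m M -> 'rV[R]_m -> R) :=
  forall c c' p, atlas M c -> atlas M c' -> chart_dom c p -> chart_dom c' p ->
    F c (c p) = F c' (c' p).

Lemma glueE F c p : chart_compatible F -> atlas M c -> chart_dom c p ->
  glue F p = F c (c p).
Proof.
by move=> Fc ac cp; apply: Fc => //; [exact: atlas_chart_at | exact: chart_at_dom].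
Qed.

Lemma glue_smooth F : chart_compatible F ->
  (forall c, atlas M c -> smooth_on (chart_img c) (F c)) -> glue F \in smooth_fun (M := M).
Proof.
move=> Fc sF; apply/smooth_funP => c ac.
apply: (smooth_on_eq (open_chart_img c) (f := F c)); last exact: sF.
by move=> x [p cp <-]; rewrite /= chart_mapK // (glueE Fc ac cp).
Qed.
End Charts.

Section MultivectorBracket.
Context {R : realType} {m : nat} {M : manifold R m}.
Variables (j : nat) (P : ext_field M) (hP : multivector_field j P).
Implicit Types (f : 'I_j -> Cinf M).

Let local_bracket f (c : chart R m M) (x : 'rV[R]_m) : R :=
  ext_pair (wedge_differentials f c x) (P c x).

Fact multivector_bracket_compatible f : chart_compatible (local_bracket f).
Proof.
move=> c c' p ac ac' cp c'p; rewrite /local_bracket (hP.2 c c' p ac ac' cp c'p).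
rewrite ext_pair_map; last by have [hom _] := hP.1 c ac; apply: hom; exact: chart_img_map.
by congr (ext_pair (wedge_all _) _); apply/funext => i; exact: gradient_transition.
Qed.

Fact multivector_bracket_smooth f c : atlas M c -> smooth_on (chart_img c) (local_bracket f c).
Proof.
move=> ac; apply: smooth_ext_pair; first exact: open_chart_img.
  apply: smooth_ext_wedge_all; first exact: open_chart_img.
  move=> l i; apply: (eq_smooth_on (f := 'D_(delta_mx 0 i) (f l \o chart_inv c))).
    by move=> x; rewrite mxE.
  by apply: smooth_on_derive; exact: smooth_near_chart.
by have [_ sP] := hP.1 c ac; exact: sP.
Qed.

Definition multivector_bracket f : Cinf M :=
  MkCinf (glue_smooth (@multivector_bracket_compatible f) (@multivector_bracket_smooth f)).

Lemma multivector_bracketE f c p : atlas M c -> chart_dom c p ->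
  multivector_bracket f p = ext_pair (wedge_differentials f c (c p)) (P c (c p)).
Proof. exact: glueE (@multivector_bracket_compatible f). Qed.

Lemma generated_by_multivector_bracket : generated_by multivector_bracket P.
Proof. by split=> // f c p; exact: multivector_bracketE. Qed.

Lemma Cinf_eq (g h : Cinf M) : (forall p, g p = h p) -> g = h.
Proof. by move=> gh; apply: val_inj; apply/funext. Qed.

Let bracket_at f p : multivector_bracket f p =
  ext_pair (wedge_differentials f (chart_at p) (chart_at p p)) (P (chart_at p) (chart_at p p)).
Proof. by []. Qed.

(** The common source of linearity and of the Leibniz rule: h is a sum or a
    product of g1 and g2, with constant or pointwise coefficients k1 and k2. *)
Lemma gradient_lincomb (g1 g2 h : Cinf M) (k1 k2 : R) p (c := chart_at p) :
  (forall v, derivable (g1 \o chart_inv c) (c p) v -> derivable (g2 \o chart_inv c) (c p) v ->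
   'D_v (h \o chart_inv c) (c p) =
     k1 *: 'D_v (g1 \o chart_inv c) (c p) + k2 *: 'D_v (g2 \o chart_inv c) (c p)) ->
  gradient h c (c p) = k1 *: gradient g1 c (c p) + k2 *: gradient g2 c (c p).
Proof.
move=> hD; apply/rowP => i; rewrite !mxE hD //.
  by apply: smooth_on_derivable (chart_img_map (chart_at_dom p)); exact: smooth_near_chart (atlas_chart_at p).
by apply: smooth_on_derivable (chart_img_map (chart_at_dom p)); exact: smooth_near_chart (atlas_chart_at p).
Qed.

Lemma multivector_bracket_lincomb f i (g1 g2 h : Cinf M) (k1 k2 : R) p
    (c := chart_at p) :
  gradient h c (c p) = k1 *: gradient g1 c (c p) + k2 *: gradient g2 c (c p) ->
  multivector_bracket [eta f with i |-> h] p =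
  k1 * multivector_bracket [eta f with i |-> g1] p +
  k2 * multivector_bracket [eta f with i |-> g2] p.
Proof.
move=> gradh; rewrite !bracket_at /wedge_differentials.
rewrite (@wedge_all_multilinear _ _ _ i k1 k2 _
  (fun l => gradient ([eta f with i |-> g1] l) c (c p))
  (fun l => gradient ([eta f with i |-> g2] l) c (c p))).
- by rewrite ext_pairC linearD !linearZ /= ![ext_pair (P _ _) _]ext_pairC.
- by rewrite /= eqxx.
- by move=> l /negPf li; rewrite /= li.
- by move=> l /negPf li; rewrite /= li.
Qed.

Lemma multivector_bracket_linear : bracket_linear multivector_bracket.
Proof.
move=> f i a g h; apply: Cinf_eq => p.
rewrite (@multivector_bracket_lincomb f i g h _ a 1); first by rewrite mul1r.
apply: gradient_lincomb => v dg dh.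
rewrite scale1r -deriveZ // -deriveD //.
exact: derivableZ.
Qed.

Lemma multivector_bracket_leibniz : bracket_leibniz multivector_bracket.
Proof.
move=> f i g h; apply: Cinf_eq => p.
rewrite (@multivector_bracket_lincomb f i h g _ (g p) (h p)).
  by rewrite [X in _ + X]mulrC.
apply: gradient_lincomb => v dh dg.
have gE (k : Cinf M) : k p = (k \o chart_inv (chart_at p)) (chart_at p p).
  by rewrite /= chart_mapK //; exact: chart_at_dom.
by rewrite (gE g) (gE h) -deriveM.
Qed.

Lemma multivector_bracket_antisymmetric : bracket_antisymmetric multivector_bracket.
Proof.
move=> f s; apply: Cinf_eq => p.
have -> : ((-1) ^+ s * multivector_bracket f) p = (-1) ^+ s * multivector_bracket f p.
  by case: (odd_perm s).
rewrite !bracket_at /wedge_differentials.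
rewrite (wedge_all_perm (fun l => gradient (f l) (chart_at p) (chart_at p p)) s).
by rewrite ext_pairC linearZ /= ext_pairC.
Qed.
End MultivectorBracket.

(** * The powers of the Poisson tensor *)

Section PoissonTensor.
Context {R : realType}.

Lemma form_matrix_map m (A : 'M[R]_m) (a : ext R m) : homogeneous 2 a ->
  form_matrix (ext_map A a) = A^T *m form_matrix a *m A.
Proof.
move=> ha; apply/matrixP => i j; rewrite [LHS]mxE ext_pairC.
pose v (k : 'I_2) : 'rV[R]_m := delta_mx 0 (if k == ord0 then i else j).
rewrite -[wedge _ _](wedge_all2 v) ext_pair_map // wedge_all2 /= ext_pair_form //.
transitivity (((delta_mx 0 i : 'rV[R]_m) *m (A^T *m form_matrix a *m A) *m (delta_mx 0 j : 'rV[R]_m)^T) 0 0).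
  by rewrite /v /= trmx_mul trmxK !mulmxA.
by rewrite vec_dot_delta -rowE mxE.
Qed.

(** J is invertible because W is. *)
Lemma invmx_congr m (J W W' : 'M[R]_m) : W \in unitmx -> W = J *m W' *m J^T ->
  invmx W' = J^T *m invmx W *m J.
Proof.
move=> uW WE; have := uW; rewrite WE !unitmx_mul => /andP[/andP[uJ uW'] uJT].
rewrite -WE in uW *.
have E : J^T *m invmx W *m J *m W' = 1%:M.
  rewrite -[LHS](mulmxK uJT); have -> : J^T *m invmx W *m J *m W' *m J^T = J^T.
    by rewrite -!mulmxA [J *m (W' *m _)]mulmxA -WE mulVmx // mulmx1.
  by rewrite mulmxV.
by rewrite -[LHS]mul1mx -E mulmxK.
Qed.

Context {n : nat} {M : manifold R n.*2}.
Variable w : symplectic_form M.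
Implicit Types (c : chart R n.*2 M) (p : M).

Lemma symplectic_homogeneous c x : atlas M c -> chart_img c x ->
  homogeneous 2 (symplectic_field w c x).
Proof.
by move=> ac cx; have [h _] := (symplectic_differential_form w).1 c ac; exact: h.
Qed.

Lemma symplectic_form_transition c c' p : atlas M c -> atlas M c' ->
  chart_dom c p -> chart_dom c' p ->
  form_matrix (symplectic_field w c (c p)) =
  transition_jacobian c c' p *m form_matrix (symplectic_field w c' (c' p))
    *m (transition_jacobian c c' p)^T.
Proof.
move=> ac ac' cp c'p; rewrite ((symplectic_differential_form w).2 c c' p) //.
rewrite form_matrix_map ?trmxK //.
by apply: symplectic_homogeneous => //; exact: chart_img_map.
Qed.

(** By [ext_pair_wedge_pow_eq] only the values of the bivector on pairs of
    covectors matter, and these transform inversely to the congruence that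
    relates the two matrices of the symplectic form. *)
Lemma poisson_tensor_pow_multivector k :
  multivector_field k.*2 (poisson_tensor_pow w k).
Proof.
split=> [c ac|c c' p ac ac' cp c'p]; first split=> [x cx|S].
- apply: homogeneous_wedge_pow; exact: homogeneous_ext_inv.
- have oc := open_chart_img c; apply: (smooth_ext_wedge_pow oc).
  apply: (smooth_ext_inv oc) => [x cx|].
    exact: symplectic_nondegenerate.
  by have [_ sw] := (symplectic_differential_form w).1 c ac.
have hL d y : homogeneous 2 (poisson_tensor w d y) by exact: homogeneous_ext_inv.
have cx := chart_img_map cp; have c'x := chart_img_map c'p.
have hLk := homogeneous_wedge_pow k (hL c (c p)).
apply: (homogeneous_eq k.*2); first exact: homogeneous_wedge_pow.
  exact: homogeneous_ext_map.
move=> s; rewrite ext_pair_map //; apply: ext_pair_wedge_pow_eq => // i j.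
rewrite !ext_pair_inv; try exact: symplectic_homogeneous; try exact: symplectic_nondegenerate.
rewrite (invmx_congr _ (symplectic_form_transition ac ac' cp c'p)).
  by rewrite !trmx_mul !trmxK !mulmxA.
exact: symplectic_nondegenerate.
Qed.

Definition poisson_pow_bracket k : ('I_k.*2 -> Cinf M) -> Cinf M :=
  multivector_bracket (poisson_tensor_pow_multivector k).

Lemma symplectic_poisson_pow_bracket k : (k <= n)%N ->
  symplectic_bracket w k (@poisson_pow_bracket k).
Proof.
move=> kn f c p ac cp; rewrite (multivector_bracketE _ _ ac cp).
apply: wedge_all_form_pow => //.
  by apply: symplectic_homogeneous => //; exact: chart_img_map.
by apply: symplectic_nondegenerate => //; exact: chart_img_map.
Qed.

(** The volume form has no zero, so it can be cancelled. *)
Lemma unique_symplectic_bracket k (br br' : ('I_k.*2 -> Cinf M) -> Cinf M) :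
  symplectic_bracket w k br -> symplectic_bracket w k br' -> br = br'.
Proof.
move=> hbr hbr'; apply/funext => f; apply: Cinf_eq => p.
have [c ac cp] := atlas_cover p; have cx := chart_img_map cp.
have := hbr f c p ac cp; rewrite -(hbr' f c p ac cp) => /eqP.
rewrite -subr_eq0 -scalerBl scaler_eq0 subr_eq0 => /orP[/eqP //|].
rewrite scaler_eq0 invr_eq0 pnatr_eq0 eqn0Ngt fact_gt0 /= => /negP[].
apply/negP; apply: wedge_pow_neq0; first exact: symplectic_homogeneous.
exact: symplectic_nondegenerate.
Qed.

End PoissonTensor.

(** * The Jacobi identity of the Poisson bracket *)

Section FlatJacobi.
Context {R : realType} {m : nat}.
Variables (D : set 'rV[R]_m) (oD : open D) (W : 'rV[R]_m -> 'M[R]_m).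
Hypothesis W_skew : forall x, (W x)^T = - W x.
Hypothesis W_unit : forall x, D x -> W x \in unitmx.
Hypothesis W_smooth : forall i j, smooth_on D (fun x => W x i j).
Implicit Types (F G H : 'rV[R]_m -> R) (x v : 'rV[R]_m).

Let L x : 'M[R]_m := (invmx (W x))^T.

Definition flat_poisson F G x : R := (grad F x *m L x *m (grad G x)^T) 0 0.

(** The Hamiltonian vector field of F. *)
Let ham F x : 'rV[R]_m := grad F x *m L x.

Let dmx v (A : 'rV[R]_m -> 'M[R]_m) x : 'M[R]_m := \matrix_(i, j) 'D_v (fun y => A y i j) x.

Let L_smooth i j : smooth_on D (fun x => L x i j).
Proof.
apply: (eq_smooth_on (f := fun x => invmx (W x) j i)) => [x|]; first by rewrite mxE.
exact: smooth_on_invmx.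
Qed.

Let L_skew x : D x -> (L x)^T = - L x.
Proof.
by move=> Dx; apply: trmx_invmx_skew => //; exact: W_unit.
Qed.

Let grad_smooth F i : smooth_on D F -> smooth_on D (fun x => grad F x 0 i).
Proof.
move=> sF; apply: (eq_smooth_on (f := 'D_(delta_mx 0 i) F)) => [x|]; first by rewrite mxE.
exact: smooth_on_derive.
Qed.

Lemma flat_poisson_smooth F G : smooth_on D F -> smooth_on D G ->
  smooth_on D (flat_poisson F G).
Proof.
move=> sF sG; apply: (eq_smooth_on (f := fun x => \sum_j (\sum_i grad F x 0 i * L x i j) * grad G x 0 j)).
  by move=> x; rewrite /flat_poisson mxE; apply: eq_bigr => j _; rewrite !mxE.
apply: smooth_on_sum => // j _; apply: smooth_onM => //; last exact: grad_smooth.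
by apply: smooth_on_sum => // i _; apply: smooth_onM => //; exact: grad_smooth.
Qed.

Let smooth_is_derive F v x : smooth_on D F -> D x -> is_derive x v F ('D_v F x).
Proof. by move=> sF Dx; apply: derivableP; exact: smooth_on_derivable sF Dx. Qed.

(** Differentiating L W^T = 1. *)
Let dmx_inverse v x : D x -> dmx v L x = L x *m dmx v W x *m L x.
Proof.
move=> Dx; have E : dmx v L x *m (W x)^T + L x *m (dmx v W x)^T = 0.
  apply/matrixP => i j; rewrite !mxE -big_split /=.
  have D1 : is_derive x v (fun y => \sum_k L y i k * W y j k)
      (\sum_k ('D_v (fun y => L y i k) x * W x j k + L x i k * 'D_v (fun y => W y j k) x)).
    by apply: is_derive_bigsum => k _; apply: is_derive_mul; exact: smooth_is_derive.
  have D2 : is_derive x v (fun y => \sum_k L y i k * W y j k) 0.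
    apply: (near_eq_is_derive _ (is_derive_cst ((i == j)%:R : R) x v)).
    apply: filterS (open_nbhs_nbhs (conj oD Dx)) => y Dy.
    have /matrixP/(_ i j) : L y *m (W y)^T = 1%:M.
      by rewrite /L -trmx_mul mulmxV ?W_unit // trmx1.
    rewrite [LHS]mxE [RHS]mxE /cst => <-.
    by apply: eq_bigr => k _; rewrite [X in _ * X]mxE.
  have := is_derive_val D1; rewrite (is_derive_val D2) => D0; rewrite [RHS]D0.
  by apply: eq_bigr => k _; rewrite !mxE.
have dW_skew : (dmx v W x)^T = - dmx v W x.
  apply/matrixP => i j; rewrite !mxE.
  have WE y : W y j i = - W y i j by have /matrixP/(_ i j) := W_skew y; rewrite !mxE.
  have -> : (fun y => W y j i) = - (fun y => W y i j) by apply/funext => y; rewrite WE.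
  by rewrite deriveN //; exact: smooth_on_derivable (W_smooth i j) Dx.
move/eqP: E; rewrite addr_eq0 dW_skew mulmxN opprK => /eqP E.
rewrite -E -mulmxA {3}/L -trmx_mul mulVmx ?W_unit // trmx1 mulmx1.
by [].
Qed.

Let derive_hessian F u v x : smooth_on D F -> D x ->
  'D_v ('D_u F) x = (u *m (\row_i 'D_v ('D_(delta_mx 0 i) F) x)^T) 0 0.
Proof.
move=> sF Dx; have DF : is_derive x v (fun y => \sum_i u 0 i * 'D_(delta_mx 0 i) F y)
    (\sum_i u 0 i * 'D_v ('D_(delta_mx 0 i) F) x).
  apply: is_derive_bigsum => i _.
  apply: (is_derive_eq (is_derive_mul (is_derive_cst (u 0 i) x v)
    (smooth_is_derive v (smooth_on_derive (delta_mx 0 i) sF) Dx))).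
  by rewrite mul0r add0r.
rewrite mxE; under eq_bigr do rewrite !mxE.
rewrite -(is_derive_val DF); apply: near_eq_derive.
apply: filterS (open_nbhs_nbhs (conj oD Dx)) => y Dy.
rewrite derive_grad; last exact: smooth_on_differentiable sF Dy.
by rewrite mxE; apply: eq_bigr => i _; rewrite !mxE.
Qed.

(** The product rule, with the derivative of L replaced by L (D_v W) L. *)
Lemma derive_flat_poisson G H v x : smooth_on D G -> smooth_on D H -> D x ->
  'D_v (flat_poisson G H) x =
  'D_v ('D_(ham G x) H) x - 'D_v ('D_(ham H x) G) x
  - (ham G x *m dmx v W x *m (ham H x)^T) 0 0.
Proof.
move=> sG sH Dx; pose dg F := \row_i 'D_v ('D_(delta_mx 0 i) F) x.
have gradD F i : smooth_on D F -> is_derive x v (fun y => grad F y 0 i) (dg F 0 i).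
  move=> sF; rewrite mxE; apply: (eq_is_derive (f := 'D_(delta_mx 0 i) F)) => [y|].
    by rewrite mxE.
  by apply: smooth_is_derive => //; exact: smooth_on_derive.
have LD i j : is_derive x v (fun y => L y i j) (dmx v L x i j).
  by rewrite mxE; exact: smooth_is_derive.
have PD : is_derive x v (flat_poisson G H)
    ((dg G *m L x *m (grad H x)^T) 0 0 + (grad G x *m dmx v L x *m (grad H x)^T) 0 0
     + (ham G x *m (dg H)^T) 0 0).
  apply: (eq_is_derive (f := fun y => \sum_j (\sum_i grad G y 0 i * L y i j) * grad H y 0 j)).
    by move=> y; rewrite /flat_poisson mxE; apply: eq_bigr => j _; rewrite !mxE.
  have DS := is_derive_bigsum (index_enum 'I_m) (P := xpredT) (fun j _ =>
    is_derive_mul (is_derive_bigsum (index_enum 'I_m) (P := xpredT) (fun i _ =>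
      is_derive_mul (gradD G i sG) (LD i j))) (gradD H j sH)).
  apply: (is_derive_eq DS); rewrite !mxE -!big_split /=; apply: eq_bigr => j _.
  rewrite big_split /= mulrDl; congr (_ * _ + _ * _ + _ * _); rewrite !mxE //.
have hess F u : smooth_on D F -> 'D_v ('D_u F) x = (u *m (dg F)^T) 0 0.
  by move=> sF; exact: derive_hessian.
rewrite (is_derive_val PD) (hess H _ sH) (hess G _ sG) (dmx_inverse v Dx).
clearbody dg.
have -> : (dg G *m L x *m (grad H x)^T) 0 0 = - (ham H x *m (dg G)^T) 0 0.
  have -> (A : 'M[R]_1) : A 0 0 = A^T 0 0 by rewrite mxE.
  by rewrite !trmx_mul trmxK mulmxA L_skew // mulmxN mulNmx mxE.
have -> : (grad G x *m (L x *m dmx v W x *m L x) *m (grad H x)^T) 0 0 =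
    - (ham G x *m dmx v W x *m (ham H x)^T) 0 0.
  have opp00 (A : 'M[R]_1) : (- A) 0 0 = - A 0 0 by rewrite mxE.
  by rewrite /ham trmx_mul L_skew // mulNmx mulmxN opp00 opprK !mulmxA.
by rewrite addrC addrA.
Qed.

Hypothesis W_closed : forall x, D x -> forall i j l,
  'D_(delta_mx 0 i) (fun y => W y j l) x + 'D_(delta_mx 0 j) (fun y => W y l i) x
  + 'D_(delta_mx 0 l) (fun y => W y i j) x = 0.

(** The exterior derivative of the form on three vectors, by trilinearity. *)
Let closed_cyclic x u v t : D x ->
  (v *m dmx u W x *m t^T) 0 0 + (t *m dmx v W x *m u^T) 0 0
  + (u *m dmx t W x *m v^T) 0 0 = 0.
Proof.
move=> Dx; pose T i j l := 'D_(delta_mx 0 i) (fun y => W y j l) x.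
have tri (a b c : 'rV[R]_m) : (b *m dmx a W x *m c^T) 0 0 =
    \sum_i \sum_j \sum_l a 0 i * b 0 j * c 0 l * T i j l.
  rewrite [RHS]exchange_big; under [RHS]eq_bigr do rewrite exchange_big /=.
  rewrite [RHS]exchange_big mxE; apply: eq_bigr => l _ /=.
  rewrite !mxE mulr_suml; apply: eq_bigr => j _; rewrite mxE.
  rewrite derive_grad; last exact: smooth_on_differentiable (W_smooth j l) Dx.
  rewrite mxE mulr_sumr mulr_suml; apply: eq_bigr => i _; rewrite !mxE /T.
  by ring.
rewrite !tri.
have -> : \sum_i \sum_j \sum_l v 0 i * t 0 j * u 0 l * T i j l =
    \sum_i \sum_j \sum_l u 0 i * v 0 j * t 0 l * T j l i.
  rewrite [RHS]exchange_big; apply: eq_bigr => i _ /=.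
  by rewrite exchange_big; apply: eq_bigr => j _ /=; apply: eq_bigr => l _; ring.
have -> : \sum_i \sum_j \sum_l t 0 i * u 0 j * v 0 l * T i j l =
    \sum_i \sum_j \sum_l u 0 i * v 0 j * t 0 l * T l i j.
  under [RHS]eq_bigr do rewrite exchange_big /=.
  rewrite [RHS]exchange_big; apply: eq_bigr => i _ /=.
  by apply: eq_bigr => j _ /=; apply: eq_bigr => l _; ring.
rewrite -!big_split big1 // => i _ /=; rewrite -!big_split big1 // => j _ /=.
rewrite -!big_split big1 // => l _ /=.
by rewrite -!mulrDr (W_closed Dx) mulr0.
Qed.

(** The brackets of brackets produce Hessians, which cancel in pairs because
    they are symmetric, and the exterior derivative of the form evaluated on
    the three Hamiltonian vector fields. *)
Lemma flat_jacobi F G H x : smooth_on D F -> smooth_on D G -> smooth_on D H -> D x ->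
  flat_poisson F (flat_poisson G H) x + flat_poisson G (flat_poisson H F) x
  + flat_poisson H (flat_poisson F G) x = 0.
Proof.
move=> sF sG sH Dx.
have dirE A B : smooth_on D B -> flat_poisson A B x = 'D_(ham A x) B x.
  by move=> sB; rewrite derive_grad //; exact: smooth_on_differentiable sB Dx.
have cancel (a b c d e f r s t : R) : a = d -> c = f -> e = b -> r + s + t = 0 ->
    (a - b - r) + (c - d - s) + (e - f - t) = 0 by lra.
rewrite !dirE; try exact: flat_poisson_smooth.
rewrite (derive_flat_poisson _ sG sH Dx) (derive_flat_poisson _ sH sF Dx)
  (derive_flat_poisson _ sF sG Dx).
apply: cancel; [exact: derive_comm oD sH Dx | exact: derive_comm oD sF Dx
  | exact: derive_comm oD sG Dx | exact: closed_cyclic].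
Qed.
End FlatJacobi.

(** * The generalized Jacobi identity *)

Section GeneralizedJacobi.
Context {R : realType} {n : nat} {M : manifold R n.*2}.
Variable w : symplectic_form M.
Variables (c : chart R n.*2 M) (ac : atlas M c).
Implicit Types (x y : 'rV[R]_n.*2) (F G H : 'rV[R]_n.*2 -> R).

Local Notation D := (chart_img c).
Let W y := form_matrix (symplectic_field w c y).
Local Notation pb := (flat_poisson W).

Let oD : open D. Proof. exact: open_chart_img. Qed.

Let W_skew y : (W y)^T = - W y. Proof. exact: form_matrix_skew. Qed.

Let W_unit y : D y -> W y \in unitmx. Proof. exact: symplectic_nondegenerate. Qed.

Let field_smooth : smooth_ext_on D (symplectic_field w c).
Proof. by have [_ sw] := (symplectic_differential_form w).1 c ac. Qed.

Let W_smooth i j : smooth_on D (fun y => W y i j).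
Proof.
apply: (eq_smooth_on (f := fun y => ext_pair (symplectic_field w c y)
  (wedge (ext_vec (delta_mx 0 i)) (ext_vec (delta_mx 0 j))))) => [y|]; first by rewrite mxE.
by apply: (smooth_ext_pair oD (a := symplectic_field w c)); [exact: field_smooth | exact: smooth_ext_cst].
Qed.

Let W_closed y : D y -> forall i j l,
  'D_(delta_mx 0 i) (fun y => W y j l) y + 'D_(delta_mx 0 j) (fun y => W y l i) y
  + 'D_(delta_mx 0 l) (fun y => W y i j) y = 0.
Proof.
move=> Dy; pose b i : ext R n.*2 :=
  [ffun S => 'D_(delta_mx 0 i) (fun y => symplectic_field w c y S) y].
have Db i : is_derive_ext y (delta_mx 0 i) (symplectic_field w c) (b i).
  by move=> S; rewrite ffunE; apply: derivableP; exact: smooth_on_derivable (field_smooth S) Dy.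
have hb i : homogeneous 2 (b i).
  move=> S; apply: contraNeq => S2; rewrite ffunE.
  apply/eqP; transitivity ('D_(delta_mx 0 i) (cst (0 : R)) y); last exact: derive_cst.
  apply: near_eq_derive; apply: filterS (open_nbhs_nbhs (conj oD Dy)) => z Dz.
  by apply/eqP; apply: contraNT S2 => /(symplectic_homogeneous ac Dz) ->.
have /sum_wedge_eq0 -/(_ hb) cyc := symplectic_closed w ac Dy.
have WE i j l : 'D_(delta_mx 0 i) (fun y => W y j l) y =
    ext_pair (wedge (ext_vec (delta_mx 0 j)) (ext_vec (delta_mx 0 l))) (b i).
  rewrite -(is_derive_val (is_derive_ext_pair _ (Db i))); congr ('D__ _ _).
  by apply/funext => z; rewrite mxE ext_pairC.
by move=> i j l; rewrite !WE cyc.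
Qed.

Lemma flat_poisson_skew F G y : D y -> pb F G y = - pb G F y.
Proof.
move=> Dy; rewrite /flat_poisson.
have -> (A : 'M[R]_1) : A 0 0 = A^T 0 0 by rewrite mxE.
have opp00 (A : 'M[R]_1) : (- A) 0 0 = - A 0 0 by rewrite mxE.
rewrite !trmx_mul trmxK (inv_form_skew (W_unit Dy)) mulNmx mulmxN opp00 mulmxA.
by rewrite mxE.
Qed.

Lemma pair_grad_poisson F G y : D y ->
  ext_pair (wedge (ext_vec (grad F y)) (ext_vec (grad G y))) (poisson_tensor w c y) = pb F G y.
Proof. by move=> Dy; rewrite ext_pair_inv //; exact: W_unit. Qed.

Lemma poisson_pow_bracket_chart k (f : 'I_k.*2 -> Cinf M) y : D y ->
  poisson_pow_bracket w f (chart_inv c y) =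
  ext_pair (wedge_all (fun i => grad (f i \o chart_inv c) y))
    (wedge_pow (poisson_tensor w c y) k).
Proof.
by move=> [p cp <-]; rewrite chart_mapK // (multivector_bracketE _ _ ac cp).
Qed.

Section Family.
Variables (N : nat) (F : 'I_N -> 'rV[R]_n.*2 -> R).
Hypothesis F_smooth : forall i, smooth_on D (F i).

Local Notation vbase i := (ext_vec (delta_mx 0 i : 'rV[R]_N)).

(** The 2-brackets of the family are the coefficients of the bivector Gm on an
    auxiliary space with one basis vector for each function; dG a is its
    derivative along the Hamiltonian vector field of F a. *)
Let gram y : 'M[R]_N := \matrix_(i, j) pb (F i) (F j) y.
Let Gm y : ext R N := bivector (gram y).
Let dgram x (a : 'I_N) : 'M[R]_N := \matrix_(i, j) pb (F a) (pb (F i) (F j)) x.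
Let dG x a : ext R N := bivector (dgram x a).

Let gram_skew y : D y -> (gram y)^T = - gram y.
Proof. by move=> Dy; apply/matrixP => i j; rewrite !mxE flat_poisson_skew. Qed.

Let ham a x := grad (F a) x *m (invmx (W x))^T.

Let flat_poissonE a G x : smooth_on D G -> D x -> pb (F a) G x = 'D_(ham a x) G x.
Proof.
by move=> sG Dx; rewrite derive_grad //; exact: smooth_on_differentiable sG Dx.
Qed.

Let pb_smooth i j : smooth_on D (pb (F i) (F j)).
Proof. exact: (flat_poisson_smooth oD W_unit W_smooth). Qed.

Let dgram_skew x a : D x -> (dgram x a)^T = - dgram x a.
Proof.
move=> Dx; apply/matrixP => i j; rewrite !mxE !flat_poissonE //.
rewrite -deriveN; last exact: smooth_on_derivable (pb_smooth i j) Dx.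
apply: near_eq_derive; apply: filterS (open_nbhs_nbhs (conj oD Dx)) => y Dy.
by rewrite flat_poisson_skew.
Qed.

(** By [flat_jacobi], through the equivalence [sum_wedge_eq0]. *)
Lemma sum_wedge_dgram x : D x -> \sum_a wedge (vbase a) (dG x a) = 0.
Proof.
move=> Dx; apply/sum_wedge_eq0 => [a|i j l]; first exact: homogeneous_bivector.
rewrite !(ext_pair_bivector _ _ (dgram_skew _ Dx)) !vec_dot_delta -!rowE !mxE.
exact: (flat_jacobi oD W_skew W_unit W_smooth W_closed (F_smooth i) (F_smooth j) (F_smooth l)).
Qed.

(** All higher brackets of the family are coefficients of powers of Gm. *)
Let pair_gram k (q : 'I_k.*2 -> 'I_N) y : D y ->
  ext_pair (wedge_all (fun i => grad (F (q i)) y)) (wedge_pow (poisson_tensor w c y) k) =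
  ext_pair (wedge_all (fun i => delta_mx 0 (q i))) (wedge_pow (Gm y) k).
Proof.
move=> Dy; apply: ext_pair_wedge_pow_eq; [exact: homogeneous_ext_inv | exact: homogeneous_bivector|].
move=> i j; rewrite pair_grad_poisson // (ext_pair_bivector _ _ (gram_skew Dy)).
by rewrite vec_dot_delta -rowE !mxE.
Qed.

Let derive_pair_gram k (q : 'I_k.+1.*2 -> 'I_N) a x : D x ->
  'D_(ham a x) (fun y => ext_pair (wedge_all (fun i => delta_mx 0 (q i))) (wedge_pow (Gm y) k.+1)) x =
  k.+1%:R * ext_pair (wedge_all (fun i => delta_mx 0 (q i))) (wedge (dG x a) (wedge_pow (Gm x) k)).
Proof.
move=> Dx; have DG : is_derive_ext x (ham a x) Gm (dG x a).
  apply: is_derive_bivector => i j; rewrite [dgram x a i j]mxE flat_poissonE //.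
  apply: (eq_is_derive (f := pb (F i) (F j))) => [y|]; first by rewrite mxE.
  by apply: derivableP; exact: smooth_on_derivable (pb_smooth i j) Dx.
have hG y : homogeneous 2 (Gm y) by exact: homogeneous_bivector.
have hdG : homogeneous 2 (dG x a) by exact: homogeneous_bivector.
rewrite (is_derive_val (is_derive_ext_pair _ (is_derive_wedge_pow k hG hdG DG))).
by rewrite linearZ.
Qed.

(** The outer bracket is expanded along its last argument h, and h is
    differentiated along the Hamiltonian vector fields of the family, as a power
    of the bivector Gm. *)
Lemma nested_flat_bracket k (u : 'I_k.*2.+1 -> 'I_N) (t : 'I_k.+1.*2 -> 'I_N)
    (h : 'rV[R]_n.*2 -> R) (v : 'I_k.+1.*2 -> 'rV[R]_n.*2) x : D x ->
  smooth_on D h ->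
  (forall y, D y -> h y = ext_pair (wedge_all (fun i => grad (F (t i)) y))
    (wedge_pow (poisson_tensor w c y) k.+1)) ->
  (forall i : 'I_k.*2.+1, v (widen_ord (leqnSn _) i) = grad (F (u i)) x) ->
  v ord_max = grad h x ->
  ext_pair (wedge_all v) (wedge_pow (poisson_tensor w c x) k.+1) =
  k.+1%:R * k.+1%:R * \sum_a
    ext_pair (wedge_all (fun i => delta_mx 0 (u i))) (wedge (vbase a) (wedge_pow (Gm x) k)) *
    ext_pair (wedge_all (fun i => delta_mx 0 (t i))) (wedge (dG x a) (wedge_pow (Gm x) k)).
Proof.
move=> Dx sh hE vu vh; pose U := wedge_all (fun i => grad (F (u i)) x).
have hL : homogeneous 2 (poisson_tensor w c x) by exact: homogeneous_ext_inv.
have -> : wedge_all v = - wedge (ext_vec (grad h x)) U.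
  transitivity (wedge U (ext_vec (grad h x))).
    rewrite /wedge_all big_ord_recr /= vh; congr (wedge _ _).
    by apply: eq_bigr => i _; rewrite -vu.
  rewrite (wedgeC (homogeneous_wedge_all _) (homogeneous_vec _)) muln1.
  by rewrite -signr_odd /= odd_double expr1 scaleN1r.
pose eta : 'rV[R]_N := \row_a 'D_(ham a x) h x.
have etaE a : eta 0 a = k.+1%:R * ext_pair (wedge_all (fun i => delta_mx 0 (t i)))
    (wedge (dG x a) (wedge_pow (Gm x) k)).
  rewrite mxE -derive_pair_gram //; apply: near_eq_derive.
  apply: filterS (open_nbhs_nbhs (conj oD Dx)) => y Dy.
  by rewrite hE // pair_gram.
have -> : ext_pair (- wedge (ext_vec (grad h x)) U) (wedge_pow (poisson_tensor w c x) k.+1)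
    = k.+1%:R * ext_pair (wedge_all (fun i => delta_mx 0 (u i)))
        (wedge (ext_vec eta) (wedge_pow (Gm x) k)).
  rewrite ext_pairC linearN /= ext_pairC ext_pair_wedge contr_wedge_pow // linearZ /= -mulrN.
  congr (_ * _); rewrite contr_form // !ext_pair_vec_wedge -sumrN; apply: eq_bigr => i _.
  rewrite (pair_gram (fun l => u (lift i l)) Dx) -mulNr -mulrN; congr (_ * _ * _).
  rewrite [in RHS]vec_dot_delta [eta 0 _]mxE -flat_poissonE // (flat_poisson_skew _ _ Dx).
  by rewrite form_matrix_bivector //; exact: inv_form_skew (W_unit Dx).
rewrite ext_vecE wedge_suml linear_sum /= -mulrA; congr (_ * _).
rewrite mulr_sumr; apply: eq_bigr => a _.
by rewrite wedgeZl linearZ /= etaE -mulrA [_ * ext_pair (wedge_all (fun i => delta_mx 0 (t i))) _]mulrC.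
Qed.

End Family.

(** By [ext_pair_shuffle] the alternating sum over s is a multiple of one
    coefficient of the sum over a of e_a /\ Gm^k /\ dG_a /\ Gm^k. The even
    elements commute with everything, and the cyclic sum [sum_wedge_dgram]
    splits off. *)
Lemma flat_generalized_jacobi k (F : 'I_(k.*2.+1 + k.+1.*2) -> 'rV[R]_n.*2 -> R) x :
  (forall i, smooth_on D (F i)) -> D x ->
  forall h : 'S_(k.*2.+1 + k.+1.*2) -> 'rV[R]_n.*2 -> R,
  forall v : 'S_(k.*2.+1 + k.+1.*2) -> 'I_k.+1.*2 -> 'rV[R]_n.*2,
  (forall s : 'S_(k.*2.+1 + k.+1.*2), smooth_on D (h s)) ->
  (forall (s : 'S_(k.*2.+1 + k.+1.*2)) y, D y -> h s y = ext_pair (wedge_all (fun i => grad (F (s (rshift k.*2.+1 i))) y))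
    (wedge_pow (poisson_tensor w c y) k.+1)) ->
  (forall (s : 'S_(k.*2.+1 + k.+1.*2)) (i : 'I_k.*2.+1), v s (widen_ord (leqnSn _) i) = grad (F (s (lshift k.+1.*2 i))) x) ->
  (forall s : 'S_(k.*2.+1 + k.+1.*2), v s ord_max = grad (h s) x) ->
  \sum_(s : 'S_(k.*2.+1 + k.+1.*2)) (-1) ^+ s * ext_pair (wedge_all (v s)) (wedge_pow (poisson_tensor w c x) k.+1) = 0.
Proof.
move=> sF Dx h v sh hE vu vh.
under eq_bigr => s _ do rewrite (nested_flat_bracket sF Dx (sh s) (hE s) (vu s) (vh s)) mulrCA mulr_sumr.
rewrite -mulr_sumr exchange_big /=.
set G := bivector _; have hG : homogeneous 2 G by exact: homogeneous_bivector.
have [N0 shuffle] := @ext_pair_shuffle R (k.*2.+1 + k.+1.*2) k.*2.+1 k.+1.*2.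
under eq_bigr => a _ do rewrite (shuffle _ _ (fun i => delta_mx 0 i)
  (homogeneous_wedge (homogeneous_vec _) (homogeneous_wedge_pow k hG))
  (homogeneous_wedge (homogeneous_bivector _) (homogeneous_wedge_pow k hG))).
rewrite -mulr_sumr -linear_sum /=.
pose b a : ext R _ := bivector (\matrix_(i, j) pb (F a) (pb (F i) (F j)) x).
rewrite [X in ext_pair _ X](_ : _ = 0) ?linear0 ?mulr0 //.
transitivity (wedge (\sum_a wedge (ext_vec (delta_mx 0 a)) (b a)) (wedge (wedge_pow G k) (wedge_pow G k))).
  rewrite wedge_suml; apply: eq_bigr => a _.
  have hb : homogeneous 2 (b a) by exact: homogeneous_bivector.
  rewrite -wedgeA [wedge (wedge_pow G k) _]wedgeA.
  by rewrite (wedge_form_comm hb (homogeneous_wedge_pow k hG)) -!wedgeA.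
by rewrite sum_wedge_dgram // wedge0l.
Qed.
End GeneralizedJacobi.

Lemma poisson_pow_bracket_jacobi (R : realType) (n k : nat) (M : manifold R n.*2)
    (w : symplectic_form M) : bracket_jacobi (@poisson_pow_bracket R n M w k.+1).
Proof.
move=> f; apply: Cinf_eq => p; have [c ac cp] := atlas_cover p.
pose B := @poisson_pow_bracket R n M w k.+1.
pose inner (s : 'S_(k.*2.+1 + k.+1.*2)) : Cinf M := B (fun j => f (s (rshift k.*2.+1 j))).
pose outer (s : 'S_(k.*2.+1 + k.+1.*2)) (i : 'I_k.+1.*2) : Cinf M :=
  if insub (val i) is Some i' then f (s (lshift k.+1.*2 i')) else inner s.
rewrite [LHS](big_morph (fun g : Cinf M => g p) (fun _ _ => erefl) erefl).
transitivity (\sum_(s : 'S_(k.*2.+1 + k.+1.*2)) (-1) ^+ s *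
    ext_pair (wedge_all (fun i => grad (outer s i \o chart_inv c) (c p)))
      (wedge_pow (poisson_tensor w c (c p)) k.+1)).
  apply: eq_bigr => s _.
  have -> : ((-1) ^+ s * nested_bracket B (f \o s)) p = (-1) ^+ s * nested_bracket B (f \o s) p.
    by case: (odd_perm s).
  by congr (_ * _); exact: (multivector_bracketE _ _ ac cp).
apply: (@flat_generalized_jacobi R n M w c ac k (fun i => f i \o chart_inv c) (c p) _ _
  (fun s => inner s \o chart_inv c)).
- by move=> i; exact: smooth_near_chart.
- exact: chart_img_map.
- by move=> s; exact: smooth_near_chart.
- move=> s y Dy; exact: (@poisson_pow_bracket_chart R n M w c ac k.+1
    (fun j => f (s (rshift k.*2.+1 j))) y Dy).
- by move=> s i; rewrite /outer (_ : insub _ = Some i) //; exact: valK.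
- by move=> s; rewrite /outer insubF //= ltnn.
Qed.

Theorem theorem2 (R : realType) (n k : nat) (M : manifold R n.*2)
    (w : symplectic_form M) (hk : (1 <= k <= n)%N) :
  exists br : ('I_(k.*2) -> Cinf M) -> Cinf M,
    [/\ unique (symplectic_bracket w k) br,
        generated_by br (poisson_tensor_pow w k)
      & poisson_bracket br].
Proof.
have /andP[k_gt0 kn] := hk.
exists (@poisson_pow_bracket R n M w k); split.
- by split=> [|br' hbr']; [|apply: unique_symplectic_bracket hbr']; exact: symplectic_poisson_pow_bracket.
- exact: generated_by_multivector_bracket.
- split; first exact: multivector_bracket_linear.
  + exact: multivector_bracket_antisymmetric.
  + exact: multivector_bracket_leibniz.
  + by case: k k_gt0 {kn hk} => // k _; exact: poisson_pow_bracket_jacobi.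
Qed.
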